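(* For all integers $k > d \geq 1$ and every $\varepsilon > 0$ there exists $\ell_0$ such that for every integer $\ell \geq \ell_0$ there exist $c_0, \eta_0 > 0$ such that for all $0 < c \leq c_0$ and $0 < \eta \leq \eta_0$ there exists $n_0$ such that the following holds for every $n \geq n_0$. Let $m = (\log n)^c$ and let $H$ be an $n$-vertex $k$-graph with \[ \delta_d(H) \geq \left( \delta^{\mathrm{LHC}}_{k,d} + \varepsilon \right) \binom{n-d}{k-d}. \] Then all but at most $\eta n$ vertices of $H$ can be covered by pairwise vertex-disjoint $m$-blow-ups of $k$-uniform loose cycles of length $\ell$ (each a subgraph of $H$).
   Context: Rounding is ignored ($m$ treated as an integer). $\delta_d(H)$ is the minimum over $d$-subsets $S \subseteq V(H)$ of the number of edges of $H$ containing $S$. The $k$-expansion of a graph replaces each edge $uv$ by a $k$-edge consisting of $u$, $v$ and $k-2$ new vertices belonging to no other edge; a $k$-uniform loose cycle of length $\ell$ is the $k$-expansion of a graph cycle with $\ell$ edges, and a loose Hamilton cycle of $H$ is a loose cycle spanning $V(H)$. For $n$ divisible by $k-1$, $\delta^{\mathrm{LHC}}_{k,d}(n)$ is the maximum of $\delta_d(H)$ over $n$-vertex $k$-graphs $H$ without a loose Hamilton cycle, and $\delta^{\mathrm{LHC}}_{k,d} := \limsup_{n\to\infty} \delta^{\mathrm{LHC}}_{k,d}(n)/\binom{n-d}{k-d}$. The $m$-blow-up of a $k$-graph $F$ replaces each vertex $x$ by a set of $m$ vertices (a cluster) $V_x$ and each edge $\{x_1,\dots,x_k\}$ by the complete $k$-partite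 $k$-graph on $V_{x_1},\dots,V_{x_k}$. *)

(* Defs.v *)
From HB Require Import structures.
From mathcomp Require Import all_boot all_order all_algebra.
From mathcomp Require Import all_classical all_reals all_analysis.
Set Implicit Arguments. Unset Strict Implicit. Unset Printing Implicit Defensive.
Import Order.TTheory GRing.Theory Num.Theory.

Definition kgraph (n k : nat) (H : {set {set 'I_n}}) : bool :=
  [forall e in H, #|e| == k].

Definition codeg (n : nat) (H : {set {set 'I_n}}) (S : {set 'I_n}) : nat :=
  #|[set e in H | S \subset e]|.

(* delta_d(H): minimum over d-subsets S of codeg H S
   (the default #|H| is an upper bound of every codeg, so it is harmless). *)
Definition min_codeg (n d : nat) (H : {set {set 'I_n}}) : nat :=
  \big[minn/#|H|]_(S : {set 'I_n} | #|S| == d) codeg H S.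

(* Vertices of the k-expansion of the graph cycle C_l (core vertices 0..l-1,
   and k-2 new vertices for each edge i(i+1)). *)
Definition LCV (k l : nat) : finType := ('I_l + 'I_l * 'I_(k - 2))%type.

Definition lc_edge (k l : nat) (i : 'I_l) : {set LCV k l} :=
  [set (inl i : LCV k l); inl (ordS i)] :|: [set (inr (i, j) : LCV k l) | j : 'I_(k - 2)].

(* Edge set of the k-uniform loose cycle of length l (for l >= 3). *)
Definition lc_edges (k l : nat) : {set {set LCV k l}} :=
  [set lc_edge k i | i : 'I_l].

Definition hasLHC (n k : nat) (H : {set {set 'I_n}}) : bool :=
  [exists l : 'I_n.+1, (3 <= l) &&
    [exists f : {ffun LCV k l -> 'I_n},
      [&& injectiveb f, [forall y : 'I_n, exists x, f x == y] &
          [forall e in lc_edges k l, (f @: e) \in H]]]].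

Definition dLHC_n (k d n : nat) : nat :=
  \max_(H : {set {set 'I_n}} | kgraph k H && ~~ hasLHC k H) min_codeg d H.

(* delta^LHC_{k,d} := limsup over n (divisible by k-1) of
   dLHC_n k d n / C(n-d, k-d); written along the subsequence n = (k-1) N. *)
Definition dLHC (R : realType) (k d : nat) : R :=
  limn_sup (fun N : nat =>
    ((dLHC_n k d ((k - 1) * N))%:R / ('C((k - 1) * N - d, k - d))%:R : R)%R).

(* f is an embedding into H of the m-blow-up of the k-uniform loose cycle of
   length l: clusters V_x = {(x,a) | a < m}; every k-partite k-tuple over the
   clusters of an edge of the cycle is an edge of H. *)
Definition blowup_copy (n k l m : nat) (H : {set {set 'I_n}})
    (f : LCV k l * 'I_m -> 'I_n) : Prop :=
  injective f /\
  forall e, e \in lc_edges k l -> forall g : LCV k l -> 'I_m,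
    [set f (x, g x) | x in e] \in H.

(* Main.v *)
Require Import Defs.
From HB Require Import structures.
From mathcomp Require Import all_boot all_order all_algebra.
From mathcomp Require Import zify.
Set Implicit Arguments. Unset Strict Implicit. Unset Printing Implicit Defensive.

(** Write [s = l (k - 1)]. By McDiarmid's inequality, for every vertex [w] all but
    a fraction [1 / (2 s)] of the [s]-tuples through [w] induce a [k]-graph whose
    minimum [d]-degree exceeds the loose Hamilton threshold, hence contain a
    spanning loose cycle of length [l]. Given any weights on the vertices, a
    positive fraction of these good tuples has average weight at most the global
    average plus one; by pigeonhole and Erdős's theorem on complete [s]-partite
    subgraphs there is a blow-up of the cycle, with clusters of size [C m], of the
    same low average weight. Choosing blow-ups one after the other, with weights
    the current coverage numbers, yields possibly overlapping blow-ups covering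
    almost every vertex about equally often (second moment). Hall's theorem then
    assigns the vertices to the blow-ups so that disjoint [m]-blow-ups cover
    almost everything. *)

(** * Hall's theorem *)

(** The minimum degree of [H] need not survive on the uncovered vertices, so blow-ups are not
    removed one at a time: each is sought in all of [H], and weights instead of deletions steer it
    to fresh vertices. This is why bad tuples are bounded through every single vertex: the cheapest
    vertices, whichever they are, must start many good tuples. The fraction [1 / (2 s)] fits
    Markov's inequality, which leaves a fraction [1 / s] of cheap completions of a cheap vertex; at
    least half of these are good. One integer [h], at least [(3 + 8 s) / eta], sets the constants. A
    cluster has [(h^4 + 2 h^3) m] vertices; up to [h^3 m] of them may be given up as covered too
    often, and the remaining [(h^4 + h^3) m] meet Hall's condition. Both the surplus and the
    discarded blow-ups then cost only [O(n / h)] vertices for fixed [s]. Probabilities are counts of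
    functions with denominators multiplied out. *)

Section Hall.
Local Open Scope nat_scope.
Variables (I V : finType) (v0 : V).

(** Halmos and Vaughan's induction on [S]: a tight proper nonempty subset splits the problem in two;
    without one, every such subset has a candidate to spare, so any choice for [i0] is safe. *)
Lemma hall_marriage (S : {set I}) (A : I -> {set V}) :
  (forall J : {set I}, J \subset S -> #|J| <= #|\bigcup_(i in J) A i|) ->
  exists f : I -> V, {in S &, injective f} /\ {in S, forall i, f i \in A i}.
Proof.
have [N leN] := ubnP #|S|; elim: N S A leN => // N IHN S A leN hallA.
have [->|[i0 i0S]] := set_0Vmem S.
  by exists (fun=> v0); split=> i; rewrite inE.
have bigUsub B (J : {set I}) :
    \bigcup_(i in J) (A i :\: B) = (\bigcup_(i in J) A i) :\: B.
  apply/setP=> v; rewrite in_setD; apply/bigcupP/andP.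
    by case=> i iJ; rewrite in_setD => /andP[vB vA]; split=> //; apply/bigcupP; exists i.
  by case=> vB /bigcupP[i iJ vA]; exists i => //; rewrite in_setD vB.
case: (boolP [exists J : {set I}, [&& J \proper S, J != set0 &
    #|\bigcup_(i in J) A i| == #|J|]]) => [/existsP[J /and3P[JS J0 /eqP cJ]]|tight].
  have sJS := proper_sub JS.
  have ltJ : #|J| < N by rewrite -ltnS (leq_trans _ leN) // ltnS proper_card.
  have [f1 [f1inj f1A]] := IHN J A ltJ (fun K KJ => hallA K (subset_trans KJ sJS)).
  set B := \bigcup_(i in J) A i in cJ *.
  have ltSJ : #|S :\: J| < N.
    rewrite -ltnS (leq_trans _ leN) // ltnS cardsD (setIidPr sJS).
    by have := subset_leq_card sJS; rewrite -card_gt0 in J0; lia.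
  have [K KS|f2 [f2inj f2A]] := IHN (S :\: J) (fun i => A i :\: B) ltSJ.
    rewrite bigUsub.
    have dKJ : [disjoint K & J].
      by rewrite disjoint_subset; apply/subsetP=> i /(subsetP KS); rewrite !inE => /andP[].
    have KJS : K :|: J \subset S by rewrite subUset sJS (subset_trans KS (subsetDl _ _)).
    have := hallA _ KJS; rewrite bigcup_setU cardsU.
    rewrite -/B -setI_eq0 in dKJ *; rewrite (eqP dKJ) cards0 subn0.
    have -> : (\bigcup_(i in K) A i) :|: B = ((\bigcup_(i in K) A i) :\: B) :|: B.
      by apply/setP=> v; rewrite !inE; case: (v \in B); rewrite ?orbT ?orbF.
    by rewrite cardsU => /leq_trans/(_ (leq_subr _ _)); rewrite cJ; lia.
  exists (fun i => if i \in J then f1 i else f2 i); split=> [i i'|i] iS; last first.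
    case: ifPn => iJ; first exact: f1A.
    by have := f2A i; rewrite !inE iJ iS => /(_ isT)/andP[].
  have f1B x : x \in J -> f1 x \in B by move=> xJ; apply/bigcupP; exists x => //; exact: f1A.
  have f2B x : x \in S -> x \notin J -> f2 x \notin B.
    by move=> xS xJ; have := f2A x; rewrite !inE xJ xS => /(_ isT)/andP[].
  move=> i'S; case: ifPn => iJ; case: ifPn => i'J.
  - exact: f1inj.
  - by move=> E; have := f1B _ iJ; rewrite E (negPf (f2B _ _ _)).
  - by move=> E; have := f1B _ i'J; rewrite -E (negPf (f2B _ _ _)).
  - by apply: f2inj; rewrite inE ?iJ ?i'J.
have [v0A] : exists v, v \in A i0.
  have := hallA [set i0]; rewrite sub1set i0S cards1 big_set1 => /(_ isT).
  by rewrite card_gt0 => /set0Pn.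
rename v0A into v => vA.
have ltS : #|S :\ i0| < N by rewrite -ltnS (leq_trans _ leN) // ltnS [X in _ < X](cardsD1 i0) i0S.
have [K KS|f [finj fA]] := IHN (S :\ i0) (fun i => A i :\: [set v]) ltS.
  rewrite bigUsub; have [->|K0] := eqVneq K set0; first by rewrite cards0.
  have KpS : K \proper S by apply: sub_proper_trans KS _; exact: properD1.
  have := hallA K (proper_sub KpS); rewrite leq_eqVlt => /orP[/eqP E|].
    by case/negP: tight; apply/existsP; exists K; rewrite KpS K0 -E eqxx.
  rewrite cardsD => ltK; have : #|\bigcup_(i in K) A i :&: [set v]| <= 1.
    by rewrite -(cards1 v) subset_leq_card ?subsetIr.
  lia.
exists (fun i => if i == i0 then v else f i); split=> [i i'|i] iS.
  have fv x : x \in S -> x != i0 -> f x != v.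
    by move=> xS xi; have := fA x; rewrite !inE xi xS => /(_ isT)/andP[].
  move=> i'S; case: eqVneq => [->|ii0]; case: eqVneq => [->|i'i0] //.
  - by move=> E; have := fv _ i'S i'i0; rewrite -E eqxx.
  - by move=> E; have := fv _ iS ii0; rewrite E eqxx.
  - by apply: finj; rewrite !inE ?ii0 ?i'i0.
case: eqVneq => [->//|ii0].
by have := fA i; rewrite !inE ii0 iS => /(_ isT)/andP[].
Qed.

(** Double counting of the pairs [(i, v)] with [i] in [J] and [v] in [A i]: at least [D] for each
    [i], at most [D] for each [v], which gives Hall's condition. *)
Lemma hall_degree (S : {set I}) (A : I -> {set V}) (D : nat) : 0 < D ->
  {in S, forall i, D <= #|A i|} ->
  (forall v, #|[set i in S | v \in A i]| <= D) ->
  exists f : I -> V, {in S &, injective f} /\ {in S, forall i, f i \in A i}.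
Proof.
move=> D0 degA degV; apply: hall_marriage => J JS.
rewrite -(leq_pmul2r D0); set B := \bigcup_(i in J) A i.
have -> : #|J| * D = \sum_(i in J) D by rewrite sum_nat_const.
apply: (@leq_trans (\sum_(i in J) #|A i|)).
  by apply: leq_sum => i iJ; apply: degA; apply: (subsetP JS).
rewrite -sum_nat_const.
have -> : \sum_(i in J) #|A i| = \sum_(i in J) \sum_(v in B) (v \in A i).
  apply: eq_bigr => i iJ; rewrite -big_mkcondr sum1_card /=.
  apply: eq_card => v; rewrite unfold_in /=.
  by apply/idP/andP=> [vA|[]//]; split=> //; apply/bigcupP; exists i.
rewrite exchange_big; apply: leq_sum => v _ /=.
apply: leq_trans (degV v); rewrite -big_mkcondr sum1_card subset_leq_card //.
by apply/subsetP=> i /andP[/= iJ vA]; rewrite inE vA (subsetP JS).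
Qed.

End Hall.

(** * Cheap tuples and complete partite subgraphs *)

Section Tuples.
Local Open Scope nat_scope.

Definition fcons {V : Type} {s : nat} (v : V) (g : {ffun 'I_s -> V}) : {ffun 'I_s.+1 -> V} :=
  [ffun i => if unlift ord0 i is Some j then g j else v].

Lemma fcons0 {V : Type} {s : nat} (v : V) (g : {ffun 'I_s -> V}) : fcons v g ord0 = v.
Proof. by rewrite ffunE unlift_none. Qed.

Lemma fconsS {V : Type} {s : nat} (v : V) (g : {ffun 'I_s -> V}) j :
  fcons v g (lift ord0 j) = g j.
Proof. by rewrite ffunE liftK. Qed.

Lemma big_fcons (R : Type) (idx : R) (op : Monoid.com_law idx) (V : finType) (s : nat)
    (F : {ffun 'I_s.+1 -> V} -> R) :
  \big[op/idx]_x F x = \big[op/idx]_v \big[op/idx]_g F (fcons v g).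
Proof.
rewrite pair_bigA /= (reindex (fun p : V * {ffun 'I_s -> V} => fcons p.1 p.2)) //=.
exists (fun x : {ffun 'I_s.+1 -> V} => (x ord0, [ffun j => x (lift ord0 j)])).
  move=> [v g] _ /=; rewrite fcons0; congr pair.
  by apply/ffunP=> j; rewrite ffunE fconsS.
move=> x _; apply/ffunP=> i; rewrite ffunE /=.
by case: unliftP => [j|] ->; rewrite ?ffunE.
Qed.

Lemma sum_ffun_coord (I V : finType) (i : I) (f : V -> nat) :
  (\sum_(g : {ffun I -> V}) f (g i)) * #|V| = #|V| ^ #|I| * \sum_v f v.
Proof.
have -> : \sum_(g : {ffun I -> V}) f (g i) =
    \sum_(g : {ffun I -> V}) \prod_j (if j == i then f (g j) else 1).
  by apply: eq_bigr => g _; rewrite -big_mkcond big_pred1_eq.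
rewrite -(bigA_distr_bigA (fun j v => if j == i then f v else 1)) (bigD1 i) //= eqxx.
rewrite [\prod_(_ | _) _](eq_bigr (fun=> #|V|)) => [|j /negPf ->]; last by rewrite sum1_card.
rewrite prod_nat_const [#|I|](cardD1 i) inE /= expnS -mulnA mulnC [_ * #|V|]mulnC.
by congr (_ * _ ^ _ * _); apply: eq_card => j; rewrite !inE andbT.
Qed.

Lemma leq_card_cover (T : finType) (A B C : {set T}) :
  A \subset B :|: C -> #|A| <= #|B| + #|C|.
Proof. by move/subset_leq_card/leq_trans; apply; exact: (leq_card_setU B C).1. Qed.

Lemma card_bool_sum (T : finType) (P : pred T) : #|[set x | P x]| = \sum_x (P x : nat).
Proof. by rewrite -sum1dep_card big_mkcond; apply: eq_bigr => x _; case: (P x). Qed.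

(** A [1 / A] quantile: [t] is the least value with the first bound, so the second follows by
    minimality. *)
Lemma quantile (V : finType) (y : V -> nat) (A : nat) : 0 < A ->
  exists t, #|V| <= A * #|[set v | y v <= t]| /\ A * #|[set v | y v < t]| <= #|V|.
Proof.
move=> A0; have ext : exists t, #|V| <= A * #|[set v | y v <= t]|.
  exists (\max_v y v); rewrite (_ : [set v | _] = setT) ?cardsT ?leq_pmull //.
  by apply/setP=> v; rewrite !inE leq_bigmax.
case: (ex_minnP ext) => t Ht mint; exists t; split=> //.
case: t Ht mint => [|t] Ht mint.
  by rewrite (_ : [set v | _] = set0) ?cards0 ?muln0 //; apply/setP=> v; rewrite !inE.
by rewrite leqNgt; apply/negP => /ltnW /mint; rewrite ltnn.
Qed.

(* Sampling the first entry among the cheapest vertices and the rest uniformly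
   works: truncating [y] at the quantile [t] of the first entry makes the
   expected cost of the rest too small for most tuples to be expensive. *)
Lemma cheap_tuples (V : finType) (s A X : nat) (P : pred {ffun 'I_s.+1 -> V}) (y : V -> nat) :
  0 < #|V| ->
  (forall w, #|[set g | ~~ P (fcons w g)]| * (2 * s.+1) <= #|V| ^ s) ->
  \sum_v y v <= X * #|V| -> 4 * X + 2 <= A ->
  #|V| ^ s.+1 <=
    #|[set x | P x && (#|V| * \sum_i y (x i) <= s.+1 * (\sum_v y v + #|V|))]| * (2 * s.+1 * A).
Proof.
set n := #|V|; set Y := \sum_v y v => n0 badP YX AX.
have [|t [tL tU]] := @quantile V y A; first lia.
set L := [set v | y v <= t] in tL; set C := [set v | y v < t] in tU.
set W := \sum_v (y v - t).
(* Pointwise, [(y v - t) + t] is the maximum of [y v] and [t]; it exceeds [y v] only on [C], by at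
   most [t]. *)
have WY : W + t * n <= Y + t * #|C|.
  have -> : t * n = \sum_(v : V) t by rewrite sum_nat_const mulnC.
  rewrite mulnC /C card_bool_sum big_distrl -!big_split leq_sum // => v _ /=.
  by case: ltnP => h; lia.
have t2X : t <= 2 * X.
  have h1 : A * (t * n) <= A * Y + t * n.
    apply: (@leq_trans (A * (Y + t * #|C|))); first by rewrite leq_mul2l; lia.
    by rewrite mulnDr leq_add2l mulnCA leq_mul2l tU orbT.
  have h2 : A * (t * n) <= (A * X + t) * n by rewrite mulnDl; nia.
  rewrite mulnA leq_pmul2r // in h2; nia.
have WE : 2 * (W + t * n) <= 2 * Y + n.
  have h : A * (t * #|C|) <= t * n by rewrite mulnCA leq_mul2l tU orbT.
  have h' : 2 * (t * n) <= A * n by rewrite mulnA leq_mul2r; lia.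
  suff : A * (2 * (W + t * n)) <= A * (2 * Y + n) by rewrite leq_pmul2l //; lia.
  nia.
(* The target [Y + n] minus the share [n * t] conceded to each entry. The subtraction does not
   truncate, and [WE] gives [W <= E]. *)
set E := Y + n - n * t.
have EE : E + n * t = Y + n by rewrite /E subnK //; lia.
have WE' : W <= E by lia.
have E0 : 0 < E by lia.
set B := [set g : {ffun 'I_s -> V} | s.+1 * (Y + n) < n * (t + \sum_i y (g i))].
(* Markov: for [g] in [B] the truncated excess [n * \sum_i (y (g i) - t)] is at least [s.+1 * E],
   while its mean [s * W] is at most [s * E]. A fraction [1 / s.+1] of all [g] avoids [B], and
   [badP] removes at most half as much. *)
have cardB : #|B| * s.+1 <= s * n ^ s.
  rewrite -(leq_pmul2r E0) -mulnA -sum_nat_const.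
  apply: (@leq_trans (\sum_(g : {ffun 'I_s -> V}) n * \sum_i (y (g i) - t))).
    rewrite [X in _ <= X](bigID (mem B)) /=; apply: leq_trans (leq_addr _ _).
    apply: leq_sum => g; rewrite inE => gB.
    have : \sum_i y (g i) <= \sum_i (y (g i) - t) + s * t.
      rewrite -[X in X * t]card_ord -sum_nat_const -big_split leq_sum // => i _ /=; lia.
    move=> le_sum; have : n * (t + \sum_i y (g i)) <= n * (t + (\sum_i (y (g i) - t) + s * t)).
      by rewrite leq_mul2l leq_add2l le_sum orbT.
    move: gB; rewrite -EE; move: (\sum_i y (g i)) (\sum_i (y (g i) - t)) => a b; nia.
  rewrite -big_distrr exchange_big /= mulnC big_distrl /=.
  rewrite (eq_bigr (fun=> n ^ s * W)); last first.
    by move=> i _; rewrite (sum_ffun_coord i (fun v => y v - t)) card_ord.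
  by rewrite sum_nat_const card_ord mulnA leq_mul2l WE' orbT.
set Q := fun x : {ffun 'I_s.+1 -> V} => P x && (n * \sum_i y (x i) <= s.+1 * (Y + n)).
have goodw w : w \in L -> n ^ s <= #|[set g | Q (fcons w g)]| * (2 * s.+1).
  rewrite inE => wt; have := badP w.
  have : n ^ s <= #|[set g | Q (fcons w g)]| + #|[set g | ~~ P (fcons w g)]| + #|B|.
    have -> : n ^ s = #|[set: {ffun 'I_s -> V}]| by rewrite cardsT card_ffun card_ord.
    rewrite -addnA; set B' := [set g | ~~ _].
    apply: (@leq_trans (#|[set g | Q (fcons w g)]| + #|B' :|: B|)); last first.
      by rewrite leq_add2l; exact: (leq_card_setU B' B).1.
    apply: leq_card_cover.
    apply/subsetP=> g _; rewrite !inE /Q.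
    case: (P _) => //=; rewrite big_ord_recl fcons0.
    rewrite (eq_bigr (fun i => y (g i))) => [|i _]; last by rewrite fconsS.
    rewrite leqNgt -implybE; apply/implyP => h; apply: leq_trans h _; rewrite leq_mul2l leq_add2r wt orbT //.
  nia.
have -> : #|[set x | P x && (n * \sum_i y (x i) <= s.+1 * (Y + n))]| =
    \sum_w #|[set g | Q (fcons w g)]|.
  by rewrite card_bool_sum big_fcons; apply: eq_bigr => w _; rewrite card_bool_sum.
rewrite mulnA expnS; apply: (@leq_trans (A * #|L| * n ^ s)); first by rewrite leq_mul2r tL orbT.
rewrite -mulnA mulnC leq_mul2r -sum_nat_const; apply/orP; right.
rewrite big_distrl [X in _ <= X](bigID (mem L)) /=; apply: leq_trans (leq_addr _ _).
by apply: leq_sum => w /goodw.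
Qed.

(** Induction on [s]. Among the tails with at least [n / (2 K)] first entries, [M] first entries are
    picked greedily, each keeping a fraction [1 / (4 K)] of the tails common to the earlier ones;
    induction then applies to the tails left. *)
Lemma complete_partite (V : finType) (s M K : nat) (G : pred {ffun 'I_s -> V}) :
  0 < K -> M * (4 * K) ^ ((M + 2) ^ s) <= #|V| -> #|V| ^ s <= #|[set x | G x]| * K ->
  exists a : 'I_s -> 'I_M -> V, (forall i, injective (a i)) /\
    forall h : 'I_s -> 'I_M, G [ffun i => a i (h i)].
Proof.
elim: s K G => [|s IHs] K G K0; set n := #|V| => Mn cG.
  exists (fun i : 'I_0 => match notF (ltn_ord i) with end); split=> [[]//|h].
  have : 0 < #|[set x | G x]| by rewrite lt0n; apply: contraTneq cG => ->.
  rewrite card_gt0 => /set0Pn[x]; rewrite inE; congr (is_true (G _)).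
  by apply/ffunP=> -[].
have [M0|M0] := posnP M.
  rewrite {}M0; exists (fun _ (i : 'I_0) => match notF (ltn_ord i) with end).
  by split=> [i []|h] //; case: (h ord0).
have MK : 4 * K * M <= n.
  apply: leq_trans Mn; rewrite mulnC leq_mul2l -{1}[4 * K]expn1 leq_exp2l; last lia.
  by rewrite expn_gt0 addn2 orbT.
have n0 : 0 < n by nia.
pose deg z := #|[set v | G (fcons v z)]|.
pose heavy z := n <= 2 * K * deg z.
have sumdeg : #|[set x | G x]| = \sum_z deg z.
  rewrite card_bool_sum big_fcons exchange_big; apply: eq_bigr => z _.
  by rewrite /deg card_bool_sum.
have card_heavy : n ^ s <= #|[set z | heavy z]| * (2 * K).
  have : \sum_z deg z * (2 * K) <= #|[set z | heavy z]| * n * (2 * K) + n ^ s * n.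
    have -> : n ^ s * n = \sum_(z : {ffun 'I_s -> V}) n.
      by rewrite sum_nat_const card_ffun card_ord.
    rewrite card_bool_sum !big_distrl -big_split leq_sum //= => z _.
    have : deg z <= n by apply: max_card.
    by rewrite /heavy; case: leqP => /= h; nia.
  rewrite -big_distrl -sumdeg /= => h.
  rewrite -(leq_pmul2l n0); rewrite expnS in cG; move: h cG.
  move: #|[set x | G x]| #|[set z | heavy z]| (n ^ s) => a b c. nia.
have greedy j : j <= M -> exists l : seq V, [/\ size l = j, uniq l &
    n ^ s <= #|[set z | heavy z && all (fun v => G (fcons v z)) l]| * (2 * K * (4 * K) ^ j)].
  elim: j => [_|j IHj jM].
    exists [::]; split=> //; rewrite expn0 muln1 (eq_card (B := [set z | heavy z])) //.
    by move=> z; rewrite !inE andbT.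
  have [l [szl ul cl]] := IHj (ltnW jM).
  set Z := [set z | _] in cl.
  pose c v := #|[set z in Z | G (fcons v z)]|.
  (* Averaging: a heavy tail has [n / (2 K)] first entries, of which at most [M <= n / (4 K)] lie in
     [l], so some [v] outside [l] serves a fraction [1 / (4 K)] of [Z]. *)
  have [v vl cv] : exists2 v, v \notin l & #|Z| <= 4 * K * c v.
    case: (pickP (fun v => (v \notin l) && (#|Z| <= 4 * K * c v))) => [v /andP[]|noV].
      by exists v.
    have Z0 : 0 < #|Z| by rewrite lt0n; apply: contraTneq cl => ->; rewrite -ltnNge expn_gt0 n0.
    have up : \sum_(v | v \notin l) (4 * K * c v).+1 <= n * #|Z|.
      apply: (@leq_trans (\sum_(v | v \notin l) #|Z|)).
        by apply: leq_sum => v vl; move: (noV v); rewrite vl /= ltnNge => ->.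
      by rewrite sum_nat_const leq_mul2r max_card orbT.
    have exch : \sum_(v | v \notin l) c v = \sum_(z in Z) #|[set v | (v \notin l) && G (fcons v z)]|.
      rewrite (eq_bigr (fun v => \sum_(z in Z) (G (fcons v z) : nat))); last first.
        by move=> v _; rewrite /c -sum1dep_card big_mkcondr; apply: eq_bigr => z _; case: (G _).
      rewrite exchange_big; apply: eq_bigr => z _.
      by rewrite -sum1dep_card big_mkcondr; apply: eq_bigr => v _; case: (G _).
    have low : #|Z| * n <= 4 * K * \sum_(v | v \notin l) c v.
      rewrite exch big_distrr -sum_nat_const leq_sum //= => z.
      rewrite inE => /andP[hz _].
      have : deg z <= #|[set v | (v \notin l) && G (fcons v z)]| + j.
        rewrite -szl -(card_uniqP ul) -(cardsE (mem l)); apply: leq_card_cover.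
        by apply/subsetP=> v; rewrite !inE => ->; case: (v \in l).
      move: hz; rewrite /heavy; move: (deg z) #|_| => a b hz ab.
      have := leq_mul (leqnn (4 * K)) ab; have := leq_mul (leqnn (4 * K)) (ltnW jM).
      by rewrite mulnDr; lia.
    have : 0 < #|[set v | v \notin l]|.
      have : n <= #|[set v | v \notin l]| + j.
        rewrite -szl -(card_uniqP ul) -(cardsE (mem l)) /n -cardsT; apply: leq_card_cover.
        by apply/subsetP=> v; rewrite !inE; case: (v \in l).
      nia.
    have : \sum_(v | v \notin l) (4 * K * c v).+1 =
        4 * K * (\sum_(v | v \notin l) c v) + #|[set v | v \notin l]|.
      rewrite -sum1dep_card big_distrr -big_split; apply: eq_bigr => v _ /=; lia.
    lia.
  exists (v :: l); split=> /=; [by rewrite szl | by rewrite vl ul|].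
  rewrite expnS; apply: (leq_trans cl).
  rewrite [X in _ <= X * _](_ : _ = c v).
    move: ((4 * K) ^ j) (c v) cv => e b cv.
    have -> : b * (2 * K * (4 * K * e)) = (4 * K * b) * (2 * K * e) by lia.
    by rewrite leq_mul2r cv orbT.
  by apply: eq_card => z; rewrite !inE [G _ && _]andbC andbA.
have [l [szl ul cl]] := greedy M (leqnn M).
have [|||a [ainj aG]] := IHs (2 * K * (4 * K) ^ M) (fun z => all (fun v => G (fcons v z)) l).
- by rewrite !muln_gt0 expn_gt0 !muln_gt0 K0.
(* Four times the new inverse density [2 * K * (4 * K) ^ M] is at most [(4 * K) ^ (M + 2)], so each
   dimension multiplies the exponent by [M + 2]. *)
- apply: leq_trans Mn; rewrite leq_mul2l [in X in _ <= X]expnS expnM leq_exp2r ?expn_gt0 ?addn2 //.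
  rewrite !expnS; apply/orP; right; nia.
- apply: leq_trans cl _; rewrite leq_mul2r subset_leq_card ?orbT //.
  by apply/subsetP=> z; rewrite !inE => /andP[].
have [v0 _] : exists v : V, true by have /card_gt0P[v] := n0; exists v.
exists (fun i => if unlift ord0 i is Some j then a j else fun r => nth v0 l r); split.
  move=> i; case: unliftP => [j _|_]; first exact: ainj.
  by move=> r r' /eqP; rewrite nth_uniq ?szl // => /eqP/val_inj.
move=> h; have /allP/(_ (nth v0 l (h ord0))) := aG (fun j => h (lift ord0 j)).
rewrite mem_nth ?szl // => /(_ isT); congr (is_true (G _)).
apply/ffunP=> i; rewrite !ffunE; case: unliftP => [j ->|-> //].
by rewrite ffunE.
Qed.

End Tuples.

(** * Evenly spread overlapping tiles *)

(** Chebyshev at one vertex: [u^2 x <= (X + u) (x - X)^2] for [x > X + u], with the square expanded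
    to avoid subtraction. For [x = X + w] and [w >= u], compare [u^2 (X + w)] with [(X + u) w^2]
    term by term. *)
Lemma overshoot_bound (u X x : nat) :
  (u ^ 2 * (if X + u < x then x else 0) + 2 * (X + u) * X * x <= (X + u) * (x ^ 2 + X ^ 2))%N.
Proof.
have -> : (2 * (X + u) * X * x = (X + u) * (2 * (X * x)))%N by lia.
case: ltnP => [lt_x|_]; last first.
  by rewrite muln0 add0n leq_mul2l [(X * x)%N]mulnC (nat_Cauchy x X).1 orbT.
have [w -> uw] : exists2 w, x = (X + w)%N & (u <= w)%N by exists (x - X)%N; lia.
have -> : ((X + w) ^ 2 + X ^ 2 = w ^ 2 + 2 * (X * (X + w)))%N by rewrite -!mulnn; lia.
rewrite [leqRHS]mulnDr leq_add2r mulnDr mulnDl; apply: leq_add.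
  by rewrite mulnC leq_mul2l leq_exp2r // uw orbT.
by rewrite -!mulnn -mulnA leq_mul2l leq_mul2r uw !orbT.
Qed.

Lemma subn_triangle (a b c : nat) : (a - c <= a - b + (b - c))%N.
Proof. lia. Qed.

Section Tiling.
Local Open Scope nat_scope.
Variables (V C : finType) (s : nat) (P : pred {ffun 'I_s.+1 -> V})
  (Q : C -> pred {ffun 'I_s.+1 -> V}).
Hypothesis V_gt0 : 0 < #|V|.
Hypothesis bad_link : forall w, #|[set g | ~~ P (fcons w g)]| * (2 * s.+1) <= #|V| ^ s.
Hypothesis PQ : forall x, P x -> exists c, Q c x.
Hypothesis Q_inj : forall c x, Q c x -> injective x.
Local Notation n := #|V|.

(** The component in [C] will be one placement of the cycle on the positions, shared by all
    transversals of the clusters; [Q c x] will say that [c] places the cycle in the tuple [x]. *)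
Definition tile M := (C * ('I_s.+1 -> 'I_M -> V))%type.

Definition tile_valid M (T : tile M) :=
  (forall i, injective (T.2 i)) /\ forall h, Q T.1 [ffun i => T.2 i (h i)].

Definition tile_count M (T : tile M) v := \sum_i \sum_r (T.2 i r == v : nat).

(** Distinct clusters are disjoint because any two of their entries lie on a common transversal,
    which [Q_inj] makes injective. *)
Lemma tile_inj M (T : tile M) i i' r r' :
  tile_valid T -> T.2 i r = T.2 i' r' -> i = i' /\ r = r'.
Proof.
move=> [inj QT] E; suff ii' : i = i' by subst i'; split=> //; exact: inj E.
have [//|ii'] := eqVneq i i'.
apply: (Q_inj (QT (fun j => if j == i then r else r'))).
by rewrite !ffunE eqxx eq_sym (negPf ii').
Qed.

Lemma tile_count_le1 M (T : tile M) v : tile_valid T -> tile_count T v <= 1.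
Proof.
move=> vT; rewrite /tile_count pair_bigA /=.
have [[i r] /= /eqP iv|none] := pickP (fun p : 'I_s.+1 * 'I_M => T.2 p.1 p.2 == v); last first.
  by rewrite big1 // => p _; rewrite none.
rewrite (bigD1 (i, r)) //= iv eqxx big1 // => [[i' r']] /= ne.
apply/eqP; rewrite eqb0; apply: contra ne => /eqP; rewrite -iv => /(tile_inj vT)[-> ->].
exact: eqxx.
Qed.

Lemma sum_tile_count M (T : tile M) (y : V -> nat) :
  \sum_v y v * tile_count T v = \sum_i \sum_r y (T.2 i r).
Proof.
under eq_bigr do rewrite big_distrr /=.
rewrite exchange_big; apply: eq_bigr => i _ /=.
under eq_bigr do rewrite big_distrr /=.
rewrite exchange_big; apply: eq_bigr => r _ /=.
rewrite (bigD1 (T.2 i r)) //= eqxx muln1 big1 ?addn0 // => v.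
by rewrite eq_sym => /negPf ->; rewrite muln0.
Qed.

Lemma size_tile M (T : tile M) : \sum_v tile_count T v = s.+1 * M.
Proof.
have := sum_tile_count T (fun=> 1); under eq_bigr do rewrite mul1n.
by move=> ->; rewrite !sum_nat_const !card_ord muln1.
Qed.

(** The inverse density fed to [complete_partite]: [cheap_tuples] with [A = 4 * X + 2] gives
    [2 * s.+1 * A], and pigeonhole over [C] costs [#|C|]. *)
Definition pattern_bound X := 2 * s.+1 * (4 * X + 2) * #|C|.

Lemma exists_cheap_tile M X (y : V -> nat) : \sum_v y v <= X * n ->
  M * (4 * pattern_bound X) ^ ((M + 2) ^ s.+1) <= n ->
  exists T : tile M, tile_valid T /\
    n * \sum_i \sum_r y (T.2 i r) <= s.+1 * M * (\sum_v y v + n).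
Proof.
move=> YX Mn; have := cheap_tuples V_gt0 bad_link YX (leqnn (4 * X + 2)).
set Y := \sum_v y v; pose cheap (x : {ffun 'I_s.+1 -> V}) := n * \sum_i y (x i) <= s.+1 * (Y + n).
set B := [set x | _] => cB.
have B0 : 0 < #|B| by rewrite lt0n; apply: contraTneq cB => ->; rewrite -ltnNge expn_gt0 V_gt0.
pose G c x := Q c x && cheap x.
have [c cG] : exists c, #|B| <= #|C| * #|[set x | G c x]|.
  have [c /= h|none] := pickP (fun c => #|B| <= #|C| * #|[set x | G c x]|); first by exists c.
  have BG : #|B| <= \sum_c #|[set x | G c x]|.
    rewrite /B card_bool_sum; under [X in _ <= X]eq_bigr do rewrite card_bool_sum.
    rewrite exchange_big leq_sum //= => x _; case: (boolP (P x)) => //= Px.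
    have [c Qc] := PQ Px; rewrite (bigD1 c) //= /G Qc.
    exact: leq_addr.
  have : \sum_c (#|C| * #|[set x | G c x]|).+1 <= #|C| * #|B|.
    by rewrite -sum_nat_const leq_sum // => c _; rewrite ltnNge none.
  have -> : \sum_c (#|C| * #|[set x | G c x]|).+1 = #|C| * (\sum_c #|[set x | G c x]|) + #|C|.
    rewrite -sum1_card big_distrr -big_split; apply: eq_bigr => c _ /=.
    by rewrite addn1.
  have C0 : 0 < #|C|.
    by have /card_gt0P[x] := B0; rewrite inE => /andP[/PQ[c _] _]; apply/card_gt0P; exists c.
  have := leq_mul (leqnn #|C|) BG; lia.
have C0 : 0 < #|C| by rewrite lt0n; apply: contraTneq cG => ->; rewrite -ltnNge.
have [||a [ainj aG]] := complete_partite (G := G c) _ Mn.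
- by rewrite /pattern_bound !muln_gt0 C0 addn2.
- apply: leq_trans cB _; rewrite /pattern_bound; move: (2 * _ * _) => a.
  by rewrite mulnCA [#|B| * a]mulnC leq_mul2l [_ * #|C|]mulnC cG orbT.
exists (c, a); split=> [|/=].
  by split=> //= h; have /andP[] := aG h.
(* The [M] diagonal transversals, one for each [r], exhaust the tile, and each is cheap. *)
rewrite exchange_big big_distrr mulnAC [_ * M]mulnC -[X in X * _]card_ord -sum_nat_const.
apply: leq_sum => r _; have /andP[_] := aG (fun=> r); rewrite /cheap.
by under eq_bigr do rewrite ffunE.
Qed.

(** A cheap tile of size [S = s.+1 * M] added to a coverage of total [N S] raises [n \sum x^2] by at
    most [2 S (N S + n) + n S]. The part [2 N S^2] goes into the growth of [(N S)^2], and [3 n S] is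
    left, so the variance stays of the order of the mean. *)
Lemma spread_tiles M X N : N * (s.+1 * M) <= X * n ->
  M * (4 * pattern_bound X) ^ ((M + 2) ^ s.+1) <= n ->
  exists T : nat -> tile M, (forall j, j < N -> tile_valid (T j)) /\
    n * \sum_v (\sum_(j < N) tile_count (T j) v) ^ 2
      <= (N * (s.+1 * M)) ^ 2 + 3 * n * (N * (s.+1 * M)).
Proof.
move=> + Mn; elim: N => [|N IHN] NX.
  have [|T _] := @exists_cheap_tile M X (fun=> 0) _ Mn; first by rewrite big1.
  exists (fun=> T); split=> //; rewrite big1 ?muln0 // => v _.
  by rewrite big_ord0.
have NX' : N * (s.+1 * M) <= X * n by apply: leq_trans NX; rewrite leq_mul2r leqnSn orbT.
have [T [vT boundT]] := IHN NX'.
pose x v := \sum_(j < N) tile_count (T j) v; rewrite -/(x _) in boundT.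
have sumx : \sum_v x v = N * (s.+1 * M).
  by rewrite exchange_big (eq_bigr (fun=> s.+1 * M)) ?sum_nat_const ?card_ord // => j _; exact: size_tile.
have [|T' [vT' cheap]] := @exists_cheap_tile M X x _ Mn; first by rewrite sumx.
exists (fun j => if j == N then T' else T j); split=> [j|].
  by rewrite ltnS leq_eqVlt; case: eqVneq => //= _; exact: vT.
have -> : \sum_v (\sum_(j < N.+1) tile_count (if j == N :> nat then T' else T j) v) ^ 2 =
    \sum_v (x v + tile_count T' v) ^ 2.
  apply: eq_bigr => v _; rewrite big_ord_recr /= eqxx; congr ((_ + _) ^ 2).
  by apply: eq_bigr => j _; rewrite ltn_eqF.
have -> : \sum_v (x v + tile_count T' v) ^ 2 =
    \sum_v x v ^ 2 + 2 * \sum_i \sum_r x (T'.2 i r) + s.+1 * M.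
  rewrite -sum_tile_count -(size_tile T') big_distrr -!big_split; apply: eq_bigr => v _ /=.
  by have := tile_count_le1 v vT'; case: (tile_count _ _) => [|[|]] //= _; lia.
move: cheap boundT; rewrite sumx.
move: (\sum_v x v ^ 2) (\sum_i _) (s.+1 * M) => a b c; nia.
Qed.

(** A tile is kept if each of its clusters has at most [r * m] vertices covered more than [q] times.
    A kept cluster offers at least [q * m] vertices to each of its [m] slots, and a vertex covered
    at most [q] times is requested by at most [q * m] slots: [hall_degree] applies. A discarded tile
    contributes more than [r * m] to the sum over overcovered vertices. *)
Lemma disjoint_subtiles M N q r m (T : nat -> tile M) : 0 < q -> 0 < m -> M = (q + r) * m ->
  (forall j, j < N -> tile_valid (T j)) ->
  let x v := \sum_(j < N) tile_count (T j) v in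
  exists (J : {set 'I_N}) (f : 'I_N * 'I_s.+1 * 'I_m -> V),
  [/\ {in [pred p | p.1.1 \in J] &, injective f},
      forall j i a, j \in J -> exists b, f (j, i, a) = (T j).2 i b &
      (N - #|J|) * (r * m) <= \sum_(v | q < x v) x v].
Proof.
move=> q0 m0 EM vT x.
pose nbad (j : 'I_N) i := #|[set b | q < x ((T j).2 i b)]|.
pose J := [set j : 'I_N | [forall i, nbad j i <= r * m]].
pose slots := [set p : 'I_N * 'I_s.+1 * 'I_m | p.1.1 \in J].
pose cl (p : 'I_N * 'I_s.+1 * 'I_m) := [set (T p.1.1).2 p.1.2 b | b : 'I_M & x ((T p.1.1).2 p.1.2 b) <= q].
have /card_gt0P[v0 _] := V_gt0.
have [|||f [finj fcl]] := @hall_degree _ _ v0 slots cl (q * m).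
- by rewrite muln_gt0 q0.
- move=> [[j i] a]; rewrite !inE => /forallP/(_ i) /= bad_le.
  rewrite /cl /= card_imset; last exact: (vT j (ltn_ord j)).1.
  suff : M <= #|[set b | x ((T j).2 i b) <= q]| + nbad j i.
    by rewrite (_ : #|[set b | _]| = #|[pred b | x ((T j).2 i b) <= q]|); [nia | exact: cardsE].
  rewrite -{1}(card_ord M) -cardsT; apply: leq_card_cover.
  by apply/subsetP=> b _; rewrite !inE; case: leqP.
- move=> v; have [xv|xv] := ltnP q (x v).
    rewrite (_ : [set p in slots | _] = set0) ?cards0 //; apply/setP=> p; rewrite !inE.
    by apply/negP=> /andP[_ /imsetP[b]]; rewrite inE => + E; rewrite -E leqNgt xv.
  apply: (@leq_trans (x v * m)); last by rewrite leq_mul2r xv orbT.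
  rewrite /x big_distrl -sum1dep_card big_mkcond /=.
  pose F p := if (p \in slots) && (v \in cl p) then 1 else 0.
  rewrite (_ : \sum_p _ = \sum_j \sum_i \sum_a F (j, i, a)); last first.
    by rewrite pair_bigA /= pair_bigA /=; apply: eq_bigr => -[[j i] a].
  rewrite /F; apply: leq_sum => j _; rewrite big_distrl leq_sum //= => i _.
  have [/existsP[b /eqP Eb]|none] := boolP [exists b, (T j).2 i b == v].
    rewrite (bigD1 b) //= Eb eqxx; apply: leq_trans (leq_mul (leq_addr _ _) (leqnn m)).
    rewrite mul1n -[X in _ <= X]muln1 -[X in _ <= X * _]card_ord -sum_nat_const leq_sum // => a _.
    by case: ifP.
  rewrite big1 // => a _; case: ifP => // /andP[_ /imsetP[b _ E]].
  by case/existsP: none; exists b; rewrite E.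
exists J, f; split.
- move=> p p' pJ p'J; apply: finj; rewrite inE; [exact: pJ | exact: p'J].
- by move=> j i a jJ; have := fcl (j, i, a); rewrite inE => /(_ jJ) /imsetP[b _ ->]; exists b.
have -> : N - #|J| = #|~: J| by rewrite [in RHS]cardsCs setCK card_ord.
rewrite -sum_nat_const /x exchange_big /= [X in _ <= X](bigID (mem (~: J))) /=.
apply: leq_trans (leq_addr _ _); apply: leq_sum => j.
rewrite !inE negb_forall => /existsP[i]; rewrite -ltnNge => /ltnW/leq_trans; apply.
rewrite /tile_count exchange_big (bigD1 i) //=; apply: leq_trans (leq_addr _ _).
rewrite exchange_big /= /nbad card_bool_sum leq_sum // => b _.
case: ltnP => //= xb; rewrite (bigD1 ((T j).2 i b)) //= eqxx; exact: leq_addr.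
Qed.

(* The tiles may overlap, but they spread evenly: the coverage numbers have
   mean about [X = h^4] and variance [O(X)], so few incidences lie over the
   vertices covered more than [h^4 + h^3] times. *)
Lemma almost_tiling h m (M := (h ^ 4 + 2 * h ^ 3) * m) : 0 < h -> 0 < m ->
  M * (4 * pattern_bound (h ^ 4)) ^ ((M + 2) ^ s.+1) <= n ->
  exists N (J : {set 'I_N}) (c : 'I_N -> C) (f : 'I_N * 'I_s.+1 * 'I_m -> V),
  [/\ {in [pred p | p.1.1 \in J] &, injective f},
      forall (j : 'I_N) g, j \in J -> Q (c j) [ffun i => f (j, i, g i)] &
      (n - s.+1 * m * #|J|) * h <= (3 + 8 * s.+1) * n].
Proof.
move=> h0 m0 Mn; set X := h ^ 4; set u := h ^ 3; set S := s.+1 * M.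
have u0 : 0 < u by rewrite expn_gt0 h0.
have C0 : 0 < #|C|.
  rewrite lt0n; apply/eqP => /card0_eq C0; have /card_gt0P[w _] := V_gt0.
  have := bad_link w; rewrite (_ : [set g | _] = setT) ?cardsT ?card_ffun ?card_ord.
    by have : 0 < n ^ s; [rewrite expn_gt0 V_gt0 | nia].
  apply/setP=> g; rewrite !inE; apply/negP=> /PQ[c _].
  by have := C0 c; rewrite inE.
have S0 : 0 < S by rewrite !muln_gt0 addn_gt0 !expn_gt0 h0 m0.
have Sn : S <= n.
  apply: leq_trans Mn; rewrite /S mulnC leq_mul2l -[X in X <= _]expn1.
  apply/orP; right; apply: (@leq_trans ((4 * pattern_bound X) ^ 1)).
    by rewrite !expn1 /pattern_bound; nia.
  by rewrite leq_pexp2l ?expn_gt0 ?addn2 // !muln_gt0 C0 addn2.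
pose N := (X * n) %/ S.
have NX : N * S <= X * n by apply: leq_trunc_div.
have XN : X * n <= N * S + S by rewrite -mulSnr ltnW // ltn_ceil.
have [T [vT boundT]] := spread_tiles NX Mn.
have [||J [f [finj fT bad]]] := @disjoint_subtiles M N (X + u) u m T _ m0 _ vT.
- by rewrite addn_gt0 u0 orbT.
- by rewrite /M /X /u; lia.
pose x v := \sum_(j < N) tile_count (T j) v.
rewrite -/(x _) in boundT bad.
have sumx : \sum_v x v = N * S.
  by rewrite exchange_big (eq_bigr (fun=> S)) ?sum_nat_const ?card_ord // => j _; exact: size_tile.
exists N, J, (fun j => (T j).1), f; split=> //.
  move=> j g jJ; have /fin_all_exists[b fb] : forall i, exists b, f (j, i, g i) = (T j).2 i b.
    by move=> i; exact: fT.
  have := (vT j (ltn_ord j)).2 b; congr (is_true (Q _ _)).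
  by apply/ffunP=> i; rewrite !ffunE fb.
set l := \sum_(v | _) x v in bad.
have cheb : u ^ 2 * l + 2 * (X + u) * X * (N * S) <= (X + u) * (\sum_v x v ^ 2 + n * X ^ 2).
  have -> : n * X ^ 2 = \sum_(v : V) X ^ 2 by rewrite sum_nat_const.
  rewrite -sumx /l [\sum_(v | _) _]big_mkcond !big_distrr -!big_split !big_distrr /=.
  by apply: leq_sum => v _; exact: overshoot_bound.
(* [D] is the loss from rounding [N]. The second moment of the coverage about [X], times [n], is its
   centred part plus [D ^ 2]. *)
have [D DE DS] : exists2 D, X * n = N * S + D & D <= S by exists (X * n - N * S); lia.
have cheb' : n * (u ^ 2 * l) <= (X + u) * (S ^ 2 + 3 * n * (N * S)).
  move: boundT cheb; rewrite -/S; move: (\sum_v _) (u ^ 2 * l) (N * S) DE => a b W DE boundT cheb.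
  have D2 : D ^ 2 <= S ^ 2 by rewrite leq_exp2r.
  have eqD : (X * n) ^ 2 + W ^ 2 = D ^ 2 + 2 * (X * n) * W by rewrite DE; lia.
  clearbody X; move: (X + u) cheb => k cheb.
  rewrite -(leq_add2r (k * (2 * (X * n) * W))).
  have -> : n * b + k * (2 * (X * n) * W) = n * (b + 2 * k * X * W) by lia.
  apply: leq_trans (leq_mul (leqnn n) cheb) _.
  have -> : n * (k * (a + n * X ^ 2)) = k * (n * a + (X * n) ^ 2) by rewrite -!mulnn; lia.
  rewrite -mulnDr leq_mul2l; apply/orP; right.
  apply: leq_trans (leq_add boundT (leqnn _)) _; rewrite addnAC [W ^ 2 + _]addnC eqD.
  by rewrite addnAC leq_add2r leq_add2r.
have l_le : l <= 8 * h ^ 2 * n.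
  have h6 : 0 < n * h ^ 6 by rewrite muln_gt0 V_gt0 expn_gt0 h0.
  rewrite -(leq_pmul2l h6).
  have -> : n * h ^ 6 * l = n * (u ^ 2 * l) by rewrite /u -expnM mulnA.
  apply: (leq_trans cheb'); apply: (@leq_trans ((2 * h ^ 4) * (n * n + 3 * n * (X * n)))).
    apply: leq_mul; first by rewrite /X /u mul2n -addnn leq_add2l leq_pexp2l.
    by apply: leq_add; [rewrite -mulnn leq_mul | rewrite leq_mul].
  have : n * n <= X * (n * n) by rewrite leq_pmull // /X expn_gt0 h0.
  have -> : n * h ^ 6 * (8 * h ^ 2 * n) = 2 * h ^ 4 * (4 * (X * (n * n))).
    by rewrite /X; lia.
  by move=> nX; rewrite leq_mul2l; apply/orP; right; lia.
have bad_le : (N - #|J|) * m * h <= 8 * n.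
  have h2 : 0 < h ^ 2 by rewrite expn_gt0 h0.
  rewrite -(leq_pmul2l h2); apply: (@leq_trans l).
    by apply: leq_trans bad; rewrite /u !expnS; lia.
  by apply: leq_trans l_le _; lia.
(* [a] counts the vertices of [N] disjoint subtiles before any is discarded. As [M = h^3 (h + 2) m],
   it falls short of [n] by at most [3 n / h]; the discarded tiles account for the other
   [8 * s.+1]. *)
set a := s.+1 * m * N; have a_le : h * n <= (h + 2) * a + n.
  have h3 : 0 < h ^ 3 by rewrite expn_gt0 h0.
  rewrite -(leq_pmul2l h3).
  have -> : h ^ 3 * (h * n) = X * n by rewrite mulnA -expnSr.
  apply: (leq_trans XN); have -> : N * S = h ^ 3 * (h + 2) * a by rewrite /S /M /a; lia.
  by rewrite [X in _ <= X]mulnDr mulnA leq_add2l (leq_trans Sn) // leq_pmull.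
have Jle : #|J| <= N by rewrite -[X in _ <= X]card_ord max_card.
have aJ : a - s.+1 * m * #|J| = s.+1 * (m * (N - #|J|)) by rewrite /a -mulnBr mulnA.
apply: (@leq_trans ((n - a) * h + (a - s.+1 * m * #|J|) * h)).
  by rewrite -mulnDl leq_mul2r subn_triangle orbT.
rewrite mulnDl; apply: leq_add.
  have [na|an] := leqP n a; first by rewrite (eqP na).
  apply: (@leq_trans ((n - a) * (h + 2))); first by rewrite leq_mul2l leq_addr orbT.
  rewrite mulnBl leq_subLR [_ * a]mulnC in a_le *.
  by rewrite mulnDr; move: a_le; rewrite [n * h]mulnC; clear; lia.
rewrite aJ -mulnA; have := leq_mul (leqnn s.+1) bad_le; clear; lia.
Qed.

End Tiling.

(** * Random tuples of vertices *)

Lemma setDUK (T : finType) (A B : {set T}) : A \subset B -> A :|: (B :\: A) = B.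
Proof. by move=> AB; rewrite setDE setUIr setUCr setIT; apply/setUidPr. Qed.

Section Sampling.
Local Open Scope nat_scope.
Variables I V : finType.
Local Notation n := #|V|.

(** Freezes the entries in [A] and resamples the others. Both arguments are full functions, so that
    no type of partial tuples enters. *)
Definition mix (A : {set I}) (a b : {ffun I -> V}) : {ffun I -> V} :=
  [ffun i => if i \in A then a i else b i].

(** Exchanging two functions outside [A] is an involution on pairs, so the mix of two independent
    uniform functions is uniform. *)
Lemma sum_mix (A : {set I}) (F : {ffun I -> V} -> nat) :
  \sum_a \sum_b F (mix A a b) = n ^ #|I| * \sum_x F x.
Proof.
rewrite -[n ^ _]card_ffun -sum1_card big_distrl /=.
under [RHS]eq_bigr do rewrite mul1n.
rewrite [RHS]exchange_big !pair_bigA /=.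
pose swap (p : {ffun I -> V} * {ffun I -> V}) := (mix A p.1 p.2, mix A p.2 p.1).
have swapK : involutive swap.
  by move=> [a b]; congr pair; apply/ffunP=> i; rewrite !ffunE /=; case: (i \in A).
by rewrite (reindex_inj (inv_inj swapK)) /=; apply: eq_bigr => -[a b] _ /=;
  have := congr1 fst (swapK (a, b)); rewrite /swap /= => ->.
Qed.

Definition update (i0 : I) (w : V) (b : {ffun I -> V}) : {ffun I -> V} :=
  [ffun i => if i == i0 then w else b i].

Lemma update_mix (A : {set I}) i0 w a b :
  i0 \in A -> update i0 w (mix A a b) = mix A (update i0 w a) b.
Proof.
move=> Ai0; apply/ffunP=> i; rewrite !ffunE.
by case: eqVneq => [->|]; rewrite ?Ai0.
Qed.

(** Union bound over ordered pairs of positions: one of the two is not [i0], stays random, and hits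
    the other's value with probability [1 / n]. *)
Lemma card_not_injective (i0 : I) (w : V) :
  #|[set b : {ffun I -> V} | ~~ injectiveb (update i0 w b)]| * n <= #|I| ^ 2 * n ^ #|I|.
Proof.
have collide i i' : i' != i0 -> i' != i ->
    #|[set b : {ffun I -> V} | update i0 w b i == update i0 w b i']| * n <= n ^ #|I|.
  move=> i'0 i'i; have [V0|V0] := posnP n; first by rewrite V0 muln0.
  have nI : 0 < n ^ #|I| by rewrite expn_gt0 V0.
  rewrite -(leq_pmul2l nI) mulnA card_bool_sum -(sum_mix [set i']) exchange_big big_distrl /=.
  rewrite -[X in X * _]card_ffun -sum_nat_const leq_sum // => b _.
  rewrite (eq_bigr (fun a : {ffun I -> V} => (a i' == update i0 w b i : nat))); last first.
    move=> a _; rewrite !ffunE (negPf i'0) !inE eqxx [i == i']eq_sym (negPf i'i) eq_sym.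
    by [].
  rewrite (sum_ffun_coord i' (fun v => (v == update i0 w b i : nat))).
  by rewrite (bigD1 (update i0 w b i)) //= eqxx big1 ?muln1 // => v /negPf ->.
apply: (@leq_trans (\sum_(i : I) \sum_(i' : I) n ^ #|I|)); last first.
  by rewrite !sum_nat_const mulnA mulnn.
pose bad i i' := [set b : {ffun I -> V} | [&& i' != i0, i' != i & update i0 w b i == update i0 w b i']].
apply: (@leq_trans (\sum_i \sum_i' #|bad i i'| * n)); last first.
  apply: leq_sum => i _; apply: leq_sum => i' _; rewrite /bad.
  case: (boolP (i' != i0)) => [i'0|_]; last first.
    by rewrite (_ : [set _ | _] = set0) ?cards0 //; apply/setP=> b; rewrite !inE.
  case: (boolP (i' != i)) => [i'i|_]; last first.
    by rewrite (_ : [set _ | _] = set0) ?cards0 //; apply/setP=> b; rewrite !inE.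
  exact: collide.
under eq_bigr do rewrite -big_distrl /=.
rewrite -big_distrl leq_mul2r /=; apply/orP; right.
rewrite card_bool_sum (eq_bigr (fun i => \sum_b \sum_i' (b \in bad i i' : nat))); last first.
  move=> i _; rewrite exchange_big; apply: eq_bigr => i' _.
  by rewrite -card_bool_sum; apply: eq_card => b; rewrite inE.
rewrite exchange_big leq_sum //= => b _.
case: injectiveP => // ninj /=.
have [[i i'] /= /andP[ii' E]|none] := pickP (fun p : I * I =>
    (p.1 != p.2) && (update i0 w b p.1 == update i0 w b p.2)); last first.
  case: ninj => i i' E; apply/eqP; move: (none (i, i')); rewrite /= E eqxx andbT.
  by move/negbT; rewrite negbK.
have [i'0|i'0] := eqVneq i' i0.
  have bbad : b \in bad i' i by rewrite inE -{1}i'0 ii' /= eq_sym E.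
  by rewrite (bigD1 i') //= (bigD1 i) //= bbad.
have bbad : b \in bad i i' by rewrite inE i'0 [i' == i]eq_sym ii' E.
by rewrite (bigD1 i) //= (bigD1 i') //= bbad.
Qed.

Lemma card_ffun_fixed (U : {set I}) (h : I -> V) :
  #|[set b : {ffun I -> V} | [forall i in U, b i == h i]]| = n ^ #|~: U|.
Proof.
pose F i : pred V := if i \in U then pred1 (h i) else predT.
have -> : #|[set b : {ffun I -> V} | [forall i in U, b i == h i]]| = #|family F|.
  apply: eq_card => b; rewrite inE; apply: eq_forallb => i.
  by transitivity (F i (b i)); rewrite // /F; case: (i \in U).
rewrite card_family foldrE big_map big_enum /=.
rewrite (bigID (mem U)) /= big1 ?mul1n => [|i iU]; last by rewrite /F iU card1.
rewrite (eq_bigr (fun=> n)) => [|i /negPf iU]; last by rewrite /F iU; apply: eq_card.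
by rewrite prod_nat_const; congr (_ ^ _); apply: eq_card => i; rewrite !inE.
Qed.

Lemma card_ffun_image (U : {set I}) (W : {set V}) : #|U| = #|W| ->
  #|U|`! * n ^ #|~: U| <= #|[set b : {ffun I -> V} | b @: U == W]|.
Proof.
move=> UW; set j := #|U|.
have [U0|[u0 u0U]] := set_0Vmem U.
  have -> : [set b : {ffun I -> V} | b @: U == W] = setT.
    apply/setP=> b; rewrite !inE U0 imset0 eq_sym -cards_eq0 -UW U0 cards0 //.
  by rewrite /j U0 cards0 fact0 mul1n setC0 !cardsT card_ffun.
pose u (p : 'I_j) := enum_val p.
pose B := [set b : {ffun I -> V} | b @: U == W].
pose inj_on := [set f : {ffun 'I_j -> V} in ffun_on (mem W) | injectiveb f].
have -> : j`! = #|inj_on| by rewrite /inj_on card_inj_ffuns_on card_ord -UW ffactnn.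
rewrite -/B -sum_nat_const -[#|B|]sum1_card.
rewrite (partition_big (fun b : {ffun I -> V} => [ffun p => b (u p)] : {ffun 'I_j -> V}) predT) //=.
rewrite [X in _ <= X](bigID (mem inj_on)) /=; apply: leq_trans (leq_addr _ _).
apply: leq_sum => f; rewrite inE => /andP[/ffun_onP fW /injectiveP finj].
rewrite sum1_card -(card_ffun_fixed U (fun i => f (enum_rank_in u0U i))).
apply/subset_leq_card/subsetP=> b; rewrite inE => /forall_inP bf.
have bu p : b (u p) = f p.
  by rewrite (eqP (bf _ (enum_valP p))) /u enum_valK_in.
rewrite unfold_in /= inE; apply/andP; split; last by apply/eqP/ffunP=> p; rewrite ffunE.
have sub : b @: U \subset W.
  by apply/subsetP=> _ /imsetP[i iU ->]; rewrite (eqP (bf i iU)); exact: fW.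
rewrite eqEcard sub -UW card_in_imset ?leqnn // => i i' iU i'U.
rewrite (eqP (bf i iU)) (eqP (bf i' i'U)) => /finj E.
by rewrite -(enum_rankK_in u0U iU) E enum_rankK_in.
Qed.

Variable H : {set {set V}}.

(** [R] will be the set of positions left random, so that for frozen other entries this count
    depends on independent entries only. *)
Definition extensions (T R : {set I}) (j : nat) (x : {ffun I -> V}) :=
  [set U : {set I} | [&& U \subset R, #|U| == j & x @: (T :|: U) \in H]].

Lemma card_extensions_le (T R : {set I}) j x : [disjoint T & R] ->
  #|extensions T R j x| <= #|[set e : {set I} | (x @: e \in H) && (T \subset e)]|.
Proof.
move=> TR; have injTU : {in extensions T R j x &, injective (fun U => T :|: U)}.
  have TUK U : U \in extensions T R j x -> (T :|: U) :\: T = U.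
    rewrite inE => /andP[UR _]; rewrite setDUl setDv set0U; apply/setDidPl.
    by rewrite disjoint_sym; exact: disjointWr UR TR.
  by move=> U U' /TUK {2}<- /TUK {2}<- ->.
rewrite -(card_in_imset injTU); apply/subset_leq_card/subsetP=> _ /imsetP[U + ->].
by rewrite !inE => /and3P[_ _ ->]; rewrite subsetUl.
Qed.

Lemma bin_le_expn a b : 'C(a, b) <= a ^ b.
Proof.
apply: leq_trans (_ : a ^_ b <= _); first by rewrite -bin_ffact leq_pmulr ?fact_gt0.
elim: b => [|b IHb]; first by [].
by rewrite ffactnSr expnSr leq_mul ?leq_subr.
Qed.

(** Only the sets [U] containing [i] are affected. This is the bounded difference for McDiarmid's
    inequality. *)
Lemma extensions_lipschitz (T R : {set I}) j (x x' : {ffun I -> V}) i :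
  i \notin T -> (forall i', i' != i -> x i' = x' i') ->
  #|extensions T R j x| <= #|extensions T R j x'| + #|I| ^ j.-1.
Proof.
move=> iT xx'; set D := [set U : {set I} | (i \in U) && (#|U| == j)].
have cardD : #|D| <= #|I| ^ j.-1.
  apply: leq_trans (bin_le_expn _ _); rewrite -card_draws.
  have Dinj : {in D &, injective (fun U : {set I} => U :\ i)}.
    by move=> U U'; rewrite !inE => /andP[iU _] /andP[iU' _] E; rewrite -(setD1K iU) E setD1K.
  rewrite -(card_in_imset Dinj); apply/subset_leq_card/subsetP=> _ /imsetP[U + ->].
  by rewrite !inE => /andP[iU /eqP <-]; rewrite [#|U|](cardsD1 i) iU.
apply: leq_trans (leq_add (leqnn _) cardD); apply: leq_card_cover.
apply/subsetP=> U; rewrite !inE => /and3P[-> -> xH] /=.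
case: (boolP (i \in U)) => iU; rewrite ?orbT // orbF.
rewrite (_ : x' @: _ = x @: (T :|: U)) //; apply: eq_in_imset => i' i'TU.
rewrite xx' //; apply: contraTneq i'TU => ->; by rewrite inE negb_or iT.
Qed.

(** The mean number of extensions, by double counting: for each [j]-set [U] in [R] and each edge [e]
    over [a @: T], at least [j! n ^ (#|I| - j)] functions map [U] onto the rest of [e]; [U] and [b]
    determine [e]. *)
Lemma sum_extensions (A T R : {set I}) j d (a : {ffun I -> V}) :
  T \subset A -> [disjoint A & R] -> #|T| = d -> {in T &, injective a} ->
  (forall e, e \in H -> #|e| = d + j) ->
  'C(#|R|, j) * (#|[set e in H | a @: T \subset e]| * (j`! * n ^ (#|I| - j)))
    <= \sum_b #|extensions T R j (mix A a b)|.
Proof.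
move=> TA AR Td Tinj Hk.
have aT : #|a @: T| = d by rewrite card_in_imset.
under eq_bigr do rewrite card_bool_sum.
rewrite exchange_big -cards_draws /= -sum_nat_const.
rewrite [X in _ <= X](bigID (fun U => U \in [set A : {set I} | A \subset R & #|A| == j])) /=.
apply: leq_trans (leq_addr _ _); apply: leq_sum => U; rewrite inE => /andP[UR /eqP Uj].
rewrite -sum_nat_const.
apply: (@leq_trans (\sum_(e in [set e in H | a @: T \subset e])
    #|[set b : {ffun I -> V} | b @: U == e :\: a @: T]|)).
  apply: leq_sum => e; rewrite inE => /andP[eH aTe].
  have -> : #|I| - j = #|~: U| by rewrite cardsCs setCK Uj.
  rewrite -[X in X`!]Uj; apply: card_ffun_image.
  by rewrite cardsD (setIidPr aTe) aT Hk // addKn.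
under eq_bigr do rewrite card_bool_sum.
rewrite exchange_big leq_sum //= => b _.
have mixTU : mix A a b @: (T :|: U) = a @: T :|: b @: U.
  rewrite imsetU; congr (_ :|: _); apply: eq_in_imset => i iTU; rewrite ffunE.
    by rewrite (subsetP TA).
  have iR := subsetP UR i iTU; rewrite ifN //.
  by apply: contraTN iR => iA; rewrite (disjointFr AR iA).
have [/exists_inP[e]|none] := boolP [exists e in [set e in H | a @: T \subset e], b @: U == e :\: a @: T].
  rewrite inE => /andP[eH aTe] /eqP bU.
  rewrite (bigD1 e) ?inE ?eH //= bU eqxx big1 => [|e' /andP[]]; last first.
    rewrite inE => /andP[_ aTe'] ne; apply/eqP; rewrite eqb0; apply: contra ne => /eqP E.
    by rewrite -(setDUK aTe') -E (setDUK aTe).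
  rewrite mixTU bU (setDUK aTe) eH UR Uj eqxx.
  by [].
rewrite big1 // => e eS; apply/eqP; rewrite eqb0; apply: contra none => h.
by apply/exists_inP; exists e.
Qed.

End Sampling.

(** * Induced [k]-graphs of tuples, their loose Hamilton cycles, and bad links *)

Section Pullback.
Local Open Scope nat_scope.

Lemma min_codeg_attained m d (G : {set {set 'I_m}}) : d <= m ->
  exists T : {set 'I_m}, #|T| = d /\ codeg G T <= min_codeg d G.
Proof.
move=> dm; rewrite /min_codeg; elim/big_ind: _ => [|x y [T [Td Tx]] [T' [T'd T'y]]|T /eqP Td].
- have : 0 < 'C(#|'I_m|, d) by rewrite card_ord bin_gt0.
  rewrite -card_draws card_gt0 => /set0Pn[T]; rewrite inE => /eqP Td; exists T; split=> //.
  by apply/subset_leq_card/subsetP=> e; rewrite inE => /andP[].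
- rewrite /minn; case: ifP => _; first by exists T.
  by exists T'.
- by exists T.
Qed.

Lemma min_codeg_le m d (G : {set {set 'I_m}}) (T : {set 'I_m}) :
  #|T| = d -> min_codeg d G <= codeg G T.
Proof.
move=> Td; rewrite /min_codeg.
have : T \in index_enum {set 'I_m} by rewrite mem_index_enum.
elim: (index_enum _) => //= S r IHr; rewrite inE big_cons => /predU1P[<-|/IHr le_r].
  by rewrite Td eqxx geq_minl.
by case: ifP => // _; apply: leq_trans (geq_minr _ _) le_r.
Qed.

Lemma codeg_le_bin m d k (G : {set {set 'I_m}}) (T : {set 'I_m}) :
  kgraph k G -> #|T| = d -> codeg G T <= 'C(m - d, k - d).
Proof.
move=> /forall_inP kG Td; set E := [set e in G | T \subset e].
have Einj : {in E &, injective (fun e => e :\: T)}.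
  move=> e e'; rewrite !inE => /andP[_ Te] /andP[_ Te'] ee'.
  by rewrite -(setDUK Te) ee' setDUK.
rewrite /codeg -/E -(card_in_imset Einj).
have -> : m - d = #|~: T| by rewrite cardsCs setCK card_ord Td.
rewrite -cards_draws; apply/subset_leq_card/subsetP=> _ /imsetP[e + ->].
rewrite !inE => /andP[eG Te]; rewrite setDE subsetIr /=.
by rewrite -setDE cardsD (setIidPr Te) Td (eqP (kG e eG)).
Qed.

Lemma dLHC_n_le_bin k d m : d <= m -> dLHC_n k d m <= 'C(m - d, k - d).
Proof.
move=> dm; apply/bigmax_leqP=> G /andP[kG _].
have [T [Td _]] := min_codeg_attained G dm.
by apply: leq_trans (min_codeg_le G Td) (codeg_le_bin kG Td).
Qed.

Lemma hasLHC_min_codeg k d s (G : {set {set 'I_s}}) :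
  kgraph k G -> dLHC_n k d s < min_codeg d G -> hasLHC k G.
Proof.
move=> kG; apply: contraTT => nG; rewrite -leqNgt /dLHC_n.
by apply: (bigmax_sup G) => //; rewrite kG.
Qed.

Definition pullback m n (H : {set {set 'I_n}}) (x : {ffun 'I_m -> 'I_n}) : {set {set 'I_m}} :=
  [set e : {set 'I_m} | x @: e \in H].

Lemma kgraph_pullback m n k (H : {set {set 'I_n}}) (x : {ffun 'I_m -> 'I_n}) :
  kgraph k H -> injective x -> kgraph k (pullback H x).
Proof.
move=> /forall_inP kH xinj; apply/forall_inP=> e; rewrite inE => /kH.
by rewrite card_imset.
Qed.

Definition pattern k l s n (H : {set {set 'I_n}}) (f : {ffun LCV k l -> 'I_s})
    (x : {ffun 'I_s -> 'I_n}) : bool :=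
  [&& injectiveb x, injectiveb f & [forall e in lc_edges k l, x @: (f @: e) \in H]].

(** [hasLHC] leaves the length open; counting vertices, [l' * (k - 1) = l * (k - 1)], forces it to
    be [l]. *)
Lemma hasLHC_pattern k l s n (H : {set {set 'I_n}}) (x : {ffun 'I_s -> 'I_n}) :
  1 < k -> s = l * (k - 1) -> injective x -> hasLHC k (pullback H x) ->
  exists f : {ffun LCV k l -> 'I_s}, pattern H f x.
Proof.
move=> k1 sE xinj /existsP[[l' l's] /= /andP[_ /existsP[f /and3P[finj fsurj fE]]]].
have l'l : l' = l.
  have /bij_eq_card : bijective f.
    apply: inj_card_bij; first exact/injectiveP.
    rewrite -cardsT -(cardsT (LCV k l')) (_ : [set: 'I_s] = f @: [set: LCV k l']) ?leq_imset_card //.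
    apply/setP=> y; rewrite inE; apply/esym/imsetP.
    by have /existsP[z /eqP <-] := forallP fsurj y; exists z.
  rewrite card_sum card_prod !card_ord sE => E.
  have : l' * (k - 1) = l * (k - 1) by rewrite -E; have -> : k - 1 = (k - 2).+1; lia.
  by move/eqP; rewrite eqn_pmul2r ?subn_gt0 // => /eqP.
subst l'; exists f; rewrite /pattern finj; apply/and3P; split=> //; first exact/injectiveP.
by apply/forall_inP=> e /(forall_inP fE); rewrite inE.
Qed.

(* Fixing an entry [w] of the tuple, the union bound over the [d]-sets of
   positions [T]; the entries in [T] and position [0] are frozen in [mix]. *)
Lemma card_bad_link n d k s t (H : {set {set 'I_n}}) (w : 'I_n) :
  d <= s.+1 -> 4 * s.+1 ^ 3 <= n ->
  (forall (T : {set 'I_s.+1}) (a : {ffun 'I_s.+1 -> 'I_n}), #|T| = d -> {in T &, injective a} ->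
    #|[set b | #|extensions H T (~: (ord0 |: T)) (k - d) (mix (ord0 |: T) a b)| < t]|
      * (4 * s.+1 ^ d.+1) <= n ^ s.+1) ->
  #|[set g : {ffun 'I_s -> 'I_n} | ~~ (injectiveb (fcons w g) && (t <= min_codeg d (pullback H (fcons w g))))]|
    * (2 * s.+1) <= n ^ s.
Proof.
move=> ds nS conc; set S := s.+1 in ds nS conc *; set j := k - d in conc.
have n0 : 0 < n by apply: leq_trans nS; rewrite muln_gt0 expn_gt0.
pose P (x : {ffun 'I_S -> 'I_n}) := injectiveb x && (t <= min_codeg d (pullback H x)).
pose few (T : {set 'I_S}) (x : {ffun 'I_S -> 'I_n}) := #|extensions H T (~: (ord0 |: T)) j x| < t.
pose inj_on (T : {set 'I_S}) (x : {ffun 'I_S -> 'I_n}) :=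
  [forall i in T, forall i' in T, (x i == x i') ==> (i == i')].
have inj_onP (T : {set 'I_S}) x : inj_on T x -> {in T &, injective x}.
  move=> /forall_inP h i i' iT i'T E.
  by have /forall_inP/(_ i' i'T) := h i iT; rewrite E eqxx => /eqP.
pose Bad (T : {set 'I_S}) := [set b : {ffun 'I_S -> 'I_n} | inj_on T (update ord0 w b) && few T (update ord0 w b)].
have cardBad (T : {set 'I_S}) : #|T| = d -> #|Bad T| * (4 * S ^ d.+1) <= n ^ S.
  move=> Td; have nSS : 0 < n ^ S by rewrite expn_gt0 n0.
  rewrite -(leq_pmul2l nSS) mulnA card_bool_sum.
  have := sum_mix (ord0 |: T) (fun b : {ffun 'I_S -> 'I_n} =>
    (inj_on T (update ord0 w b) && few T (update ord0 w b) : nat)).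
  rewrite !card_ord => <-; rewrite big_distrl /=.
  have -> : n ^ S * n ^ S = \sum_(a : {ffun 'I_S -> 'I_n}) n ^ S.
    by rewrite sum_nat_const card_ffun !card_ord.
  apply: leq_sum => a _; set a' := update ord0 w a.
  have upd b : update ord0 w (mix (ord0 |: T) a b) = mix (ord0 |: T) a' b.
    by rewrite update_mix // !inE eqxx.
  have [/inj_onP ainj|naj] := boolP (inj_on T a').
    apply: leq_trans (conc T a' Td ainj); rewrite leq_mul2r; apply/orP; right.
    rewrite card_bool_sum leq_sum // => b _; rewrite upd /few.
    by case: (inj_on _ _).
  rewrite big1 ?mul0n // => b _; apply/eqP; rewrite eqb0 upd; apply: contra naj.
  move=> /andP[/inj_onP inj _]; apply/forall_inP=> i iT; apply/forall_inP=> i' i'T.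
  have mixT z : z \in T -> mix (ord0 |: T) a' b z = a' z by move=> zT; rewrite ffunE !inE zT orbT.
  by apply/implyP=> /eqP E; apply/eqP; apply: inj; rewrite ?mixT.
pose NI := [set b : {ffun 'I_S -> 'I_n} | ~~ injectiveb (update ord0 w b)].
have cardNI : #|NI| * (4 * S) <= n ^ S.
  have := card_not_injective (ord0 : 'I_S) w; rewrite -/NI !card_ord => h.
  have S2 : 0 < S ^ 2 by rewrite expn_gt0.
  rewrite -(leq_pmul2l S2); apply: leq_trans h.
  rewrite mulnCA leq_mul2l; apply/orP; right; apply: leq_trans nS.
  by rewrite [X in _ <= 4 * X]expnS; lia.
(* At most [S ^ d] sets [T], each bad with probability [1 / (4 S^(d+1))], cost [1 / (4 S)] in total.
   [NI] costs the same, which makes up the allowed [1 / (2 S)]. *)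
have cardU : \sum_(T : {set 'I_S} | #|T| == d) #|Bad T| * (4 * S) <= n ^ S.
  have Sd : 0 < S ^ d by rewrite expn_gt0.
  rewrite -(leq_pmul2l Sd) big_distrr /=.
  apply: (@leq_trans (\sum_(T : {set 'I_S} | #|T| == d) n ^ S)).
    apply: leq_sum => T /eqP Td; apply: leq_trans (cardBad T Td).
    by rewrite expnS mulnCA [S ^ d * _]mulnC -[4 * S * _]mulnA.
  rewrite (eq_bigl (fun T => T \in [set T : {set 'I_S} | #|T| == d])) => [|T]; last by rewrite inE.
  by rewrite sum_nat_const card_draws card_ord leq_mul2r bin_le_expn orbT.
have badP : #|[set b : {ffun 'I_S -> 'I_n} | ~~ P (update ord0 w b)]| <=
    #|NI| + \sum_(T : {set 'I_S} | #|T| == d) #|Bad T|.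
  rewrite !card_bool_sum; under [X in _ <= _ + X]eq_bigr do rewrite card_bool_sum.
  rewrite exchange_big -big_split leq_sum //= => b _; rewrite /P.
  case: injectiveP => //= xinj; case: (leqP t (min_codeg d _)) => //= lt_t.
  have [T [Td Tle]] := min_codeg_attained (pullback H (update ord0 w b)) ds.
  rewrite (bigD1 T) ?Td //= (_ : _ && _ = true) //; apply/andP; split.
    apply/forall_inP=> i _; apply/forall_inP=> i' _; apply/implyP=> /eqP/xinj ->.
    exact: eqxx.
  apply: leq_ltn_trans lt_t; apply: leq_trans Tle.
  have := @card_extensions_le _ _ H T (~: (ord0 |: T)) j (update ord0 w b).
  rewrite -setI_eq0 setCU setIA setIAC setICr set0I eqxx => /(_ isT) /leq_trans; apply.
  by apply: subset_leq_card; apply/subsetP=> e; rewrite !inE.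
(* Overwriting entry [0] by [w] forgets its value, so each link tuple is counted [n] times. *)
have badg : #|[set b : {ffun 'I_S -> 'I_n} | ~~ P (update ord0 w b)]| =
    n * #|[set g | ~~ P (fcons w g)]|.
  rewrite !card_bool_sum big_fcons (eq_bigr (fun=> \sum_g (~~ P (fcons w g) : nat))).
    by rewrite sum_nat_const card_ord.
  move=> v _; apply: eq_bigr => g _; congr (nat_of_bool (~~ P _)).
  by apply/ffunP=> i; rewrite !ffunE; case: unliftP => [i' ->|->]; rewrite ?eqxx.
rewrite -big_distrl /= in cardU.
rewrite -(leq_pmul2l n0) -expnS -/S -/(P _); move: badP cardNI cardU; rewrite badg.
rewrite /P; move: #|[set g | _]| (\sum_(T | _) _) #|NI| (n ^ S) => x y z u; nia.
Qed.

End Pullback.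

(* Loaded only here because [classical_sets] shadows the names of [finset]. *)
From mathcomp Require Import all_classical all_reals all_analysis.
From mathcomp Require Import ring lra.
Import Order.TTheory GRing.Theory Num.Theory.
Local Open Scope ring_scope.

(** * Concentration *)

Section Concentration.
Variable R : realType.

(** Square [expR (z / 2) <= 1 / (1 - z / 2)] and use [(1 + z + z^2) (1 - z / 2)^2 - 1 = z^2 (1 - 3 z
    + z^2) / 4]. *)
Lemma expR_le_quadratic (z : R) : z <= 1 / 3 -> expR z <= 1 + z + z ^+ 2.
Proof.
move=> z3; have z2 : 0 < 1 - z / 2 by lra.
have le1 : 1 - z / 2 <= expR (- (z / 2)) by have := expR_ge1Dx (- (z / 2)); lra.
have le2 : expR (z / 2) <= (1 - z / 2)^-1.
  have -> : expR (z / 2) = (expR (- (z / 2)))^-1 by rewrite expRN invrK.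
  by rewrite lef_pV2 ?posrE ?expR_gt0.
have -> : expR z = expR (z / 2) ^+ 2 by rewrite expr2 -expRD; congr expR; lra.
apply: (@le_trans _ _ ((1 - z / 2)^-1 ^+ 2)).
  by rewrite ler_pXn2r // nnegrE ?expR_ge0 // invr_ge0 ltW.
rewrite exprVn -[leLHS]mul1r ler_pdivrMr ?exprn_gt0 //.
have : 0 <= z ^+ 2 * (1 - 3 * z + z ^+ 2) by apply: mulr_ge0; [exact: sqr_ge0 | nra].
by rewrite !expr2; nra.
Qed.

Variable V : finType.
Hypothesis V_gt0 : (0 < #|V|)%N.
Local Notation n := (#|V|%:R : R).

Let n_gt0 : 0 < n. Proof. by rewrite ltr0n. Qed.

(** In the quadratic bound for the exponential the linear terms cancel, as deviations from the mean
    sum to zero, and each deviation is at most [c] in absolute value. *)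
Lemma sum_expR_deviation (h : V -> R) (lam c : R) : 0 <= lam -> 0 <= c -> lam * c <= 1 / 3 ->
  (forall v v', h v <= h v' + c) ->
  \sum_v expR (lam * ((\sum_v h v) / n - h v)) <= n * expR ((lam * c) ^+ 2).
Proof.
move=> lam0 c0 lamc hc; set mu := _ / n.
have mu_n : mu * n = \sum_v h v by rewrite /mu divfK // lt0r_neq0.
have sumc (x : R) : \sum_(v : V) x = x * n by rewrite sumr_const mulr_natr; congr (_ *+ _); apply: eq_card.
have mu_le v : mu <= h v + c.
  by rewrite /mu ler_pdivrMr // -sumc ler_sum.
have mu_ge v : h v - c <= mu.
  by rewrite /mu ler_pdivlMr // -sumc ler_sum // => v' _; have := hc v v'; lra.
apply: (@le_trans _ _ (\sum_v (1 + lam * (mu - h v) + (lam * c) ^+ 2))).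
  apply: ler_sum => v _; have lo := mu_ge v; have hi := mu_le v.
  apply: le_trans (expR_le_quadratic _) _.
    by apply: le_trans lamc; rewrite ler_wpM2l //; lra.
  rewrite lerD2l !exprMn ler_wpM2l ?sqr_ge0 //.
  by rewrite -ler_sqrt ?sqr_ge0 // !sqrtr_sqr (ger0_norm c0) ler_norml; lra.
rewrite !big_split /= -mulr_sumr big_split /= sumrN !sumc mu_n subrr mulr0 addr0.
rewrite -mulrDl mulrC ler_pM2l //; exact: expR_ge1Dx.
Qed.

(** Induction on [N], revealing the first entry: the conditional mean [h v] inherits the difference
    bound [c], and the exponential splits into the deviation of [h] and, given [v], that of [g] from
    [h v]. *)
Lemma mcdiarmid N (g : {ffun 'I_N -> V} -> R) (lam c : R) :
  0 <= lam -> 0 <= c -> lam * c <= 1 / 3 ->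
  (forall (x x' : {ffun 'I_N -> V}) i, (forall i', i' != i -> x i' = x' i') -> g x <= g x' + c) ->
  \sum_x expR (lam * ((\sum_x g x) / n ^+ N - g x)) <= n ^+ N * expR ((lam * c) ^+ 2) ^+ N.
Proof.
move=> lam0 c0 lamc; elim: N g => [|N IHN] g glip.
  have x0 : {ffun 'I_0 -> V} by apply: finfun => -[].
  have all_x0 x : x = x0 by apply/ffunP=> -[].
  have big1x (F : {ffun 'I_0 -> V} -> R) : \sum_x F x = F x0.
    by rewrite (big_pred1 x0) // => x; apply/esym/eqP/all_x0.
  by rewrite !big1x !expr0 divr1 subrr mulr0 expR0 mulr1.
have nN : 0 < n ^+ N by rewrite exprn_gt0.
pose h v := (\sum_y g (fcons v y)) / n ^+ N.
have hlip v v' : h v <= h v' + c.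
  rewrite /h ler_pdivrMr // mulrDl divfK ?lt0r_neq0 //.
  have -> : c * n ^+ N = \sum_(y : {ffun 'I_N -> V}) c.
    by rewrite sumr_const -[RHS]mulr_natr card_ffun card_ord natrX.
  rewrite -big_split ler_sum // => y _; apply: (glip _ _ ord0) => i.
  by rewrite !ffunE; case: unliftP => [j -> //|->]; rewrite eqxx.
have -> : (\sum_x g x) / n ^+ N.+1 = (\sum_v h v) / n.
  by rewrite big_fcons exprSr invfM mulrA -mulr_suml.
rewrite big_fcons /=; set mu := (\sum_v h v) / n; set E := expR ((lam * c) ^+ 2).
apply: (@le_trans _ _ (\sum_v expR (lam * (mu - h v)) * (n ^+ N * E ^+ N))).
  apply: ler_sum => v _.
  rewrite (eq_bigr (fun y => expR (lam * (mu - h v)) * expR (lam * (h v - g (fcons v y))))).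
    rewrite -mulr_sumr ler_wpM2l ?expR_ge0 //; apply: (IHN (fun y => g (fcons v y))).
    move=> x x' i xx'; apply: (glip _ _ (lift ord0 i)) => i'.
    by rewrite !ffunE; case: unliftP => [j -> ne|->//]; apply: xx'; apply: contraNneq ne => ->.
  by move=> y _; rewrite -expRD -mulrDr addrA subrK.
rewrite -mulr_suml exprS [E ^+ N.+1]exprS mulrACA ler_wpM2r //.
  by rewrite mulr_ge0 ?exprn_ge0 ?expR_ge0 // ltW.
exact: sum_expR_deviation.
Qed.

(** Chernoff with [lam = tau / (2 c)]: the deviation contributes [tau^2 N / 2] to the exponent and
    the moment bound takes back half. The bound [tau <= 2 / 3] gives [lam * c <= 1 / 3]. *)
Lemma mcdiarmid_tail N (g : {ffun 'I_N -> V} -> R) (c tau : R) :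
  0 < c -> 0 <= tau -> tau <= 2 / 3 ->
  (forall (x x' : {ffun 'I_N -> V}) i, (forall i', i' != i -> x i' = x' i') -> g x <= g x' + c) ->
  (\sum_x (g x < (\sum_x g x) / n ^+ N - tau * N%:R * c)%R%:R) * expR (tau ^+ 2 * N%:R / 4) <= n ^+ N.
Proof.
move=> c0 tau0 tau1 glip; set mu := _ / _.
have cn : c != 0 by rewrite lt0r_neq0.
have := @mcdiarmid N g (tau / (2 * c)) c.
have lamc : tau / (2 * c) * c = tau / 2 by field.
rewrite lamc; have -> : expR ((tau / 2) ^+ 2) ^+ N = expR (tau ^+ 2 * N%:R / 4).
  by rewrite -expRM_natl; congr expR; field.
move=> /(_ _ _ _ glip) mc.
have {mc} : \sum_x expR (tau / (2 * c) * (mu - g x)) <= n ^+ N * expR (tau ^+ 2 * N%:R / 4).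
  by apply: mc; [apply: divr_ge0 => //; lra | exact: ltW | lra].
have e0 : 0 < expR (tau ^+ 2 * N%:R / 4) by exact: expR_gt0.
move=> mc; rewrite -(ler_pM2r e0); apply: le_trans mc.
rewrite -[leLHS]mulrA -expRD mulr_suml ler_sum // => x _.
case: ltP => gx; last by rewrite mul0r expR_ge0.
rewrite mul1r ler_expR.
have -> : tau ^+ 2 * N%:R / 4 + tau ^+ 2 * N%:R / 4 = tau / (2 * c) * (tau * N%:R * c) by field.
rewrite ler_wpM2l ?divr_ge0 //; lra.
Qed.

End Concentration.

Lemma few_extensions_tail (R : realType) (s n d k t : nat) (H : {set {set 'I_n}})
    (T : {set 'I_s.+1}) (a : {ffun 'I_s.+1 -> 'I_n}) (p tau : R) :
  (d < k)%N -> (k <= s.+1)%N -> (0 < n)%N -> kgraph k H -> #|T| = d -> {in T &, injective a} ->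
  p * 'C(n - d, k - d)%:R <= (min_codeg d H)%:R -> 0 <= p -> 0 <= tau -> tau <= 2 / 3 ->
  t%:R <= 'C(s - d, k - d)%:R * (p * 'C(n - d, k - d)%:R) * (k - d)`!%:R / n%:R ^+ (k - d)
    - tau * s.+1%:R ^+ (k - d) ->
  (4 * s.+1 ^ d.+1)%:R <= expR (tau ^+ 2 * s.+1%:R / 4) ->
  (#|[set b | (#|extensions H T (~: (ord0 |: T)) (k - d) (mix (ord0 |: T) a b)| < t)%N]|
      * (4 * s.+1 ^ d.+1) <= n ^ s.+1)%N.
Proof.
move=> dk ks n0 /forall_inP kH Td ainj degH p0 tau0 tau1 tle Bexp.
set S := s.+1 in T a ks Td ainj tle Bexp *; set j := (k - d)%N in degH tle *.
set A := ord0 |: T; pose g (b : {ffun 'I_S -> 'I_n}) : R := #|extensions H T (~: A) j (mix A a b)|%:R.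
have n0' : (0 < #|'I_n|)%N by rewrite card_ord.
have nR : 0 < (n%:R : R) by rewrite ltr0n.
have c0 : 0 < (S%:R : R) ^+ j.-1 by rewrite exprn_gt0 // ltr0n.
have glip (x x' : {ffun 'I_S -> 'I_n}) i :
    (forall i', i' != i -> x i' = x' i') -> g x <= g x' + S%:R ^+ j.-1.
  move=> xx'; rewrite /g -natrX -natrD ler_nat -[X in (_ <= _ + X ^ _)%N](card_ord S).
  have [iA|iA] := boolP (i \in A).
    suff -> : mix A a x = mix A a x' by rewrite leq_addr.
    by apply/ffunP=> i'; rewrite !ffunE; case: ifPn => // i'A; apply: xx'; apply: contraNneq i'A => ->.
  apply: (@extensions_lipschitz _ _ H T (~: A) j _ _ i) => [|i' ne].
    by apply: contra iA => iT; rewrite !inE iT orbT.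
  by rewrite !ffunE; case: ifP => // _; apply: xx'.
have := mcdiarmid_tail n0' c0 tau0 tau1 glip; rewrite card_ord.
set mu := (\sum_x g x) / _; set thr := _ - _ => tail.
have mu_ge : t%:R <= thr.
  apply: (le_trans tle); rewrite /thr; apply: lerB; last first.
    by rewrite -mulrA -exprS prednK // /j subn_gt0.
  have jS : (j <= S)%N by rewrite /j; lia.
  have := @sum_extensions _ _ H A T (~: A) j d a.
  rewrite card_ord.
  have -> : T \subset A by rewrite finset.subsetUr.
  have -> : [disjoint A & ~: A] by rewrite -finset.setI_eq0 finset.setICr.
  move=> /(_ isT isT Td ainj) sumE.
  have kdj : k = (d + j)%N by rewrite /j; lia.
  have {sumE} := sumE (fun e eH => etrans (eqP (kH e eH)) kdj); rewrite card_ord => sumE.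
  have aT : #|a @: T| = d by rewrite card_in_imset.
  have codeg_ge := min_codeg_le H aT; rewrite /codeg in codeg_ge.
  (* Position [0] is frozen besides the [d] positions of [T], hence [s - d] and not [s.+1 - d]. *)
  have cardR : (s - d <= #|~: A|)%N.
    rewrite cardsCs finset.setCK card_ord /A cardsU1 Td /S.
    by case: (ord0 \notin T); rewrite ?add1n ?add0n ?subSS // leq_sub2r.
  rewrite /mu ler_pdivlMr ?exprn_gt0 //.
  have -> : n%:R ^+ S = n%:R ^+ j * n%:R ^+ (S - j) :> R by rewrite -exprD subnKC.
  rewrite [leLHS]mulrA divfK ?expf_neq0 ?lt0r_neq0 //.
  rewrite /g -natr_sum; apply: (@le_trans _ _ _%:R); last by rewrite ler_nat; exact: sumE.
  rewrite !natrM natrX [leRHS]mulrA -[leLHS]mulrA ler_wpM2r ?mulr_ge0 ?exprn_ge0 //.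
  apply: ler_pM; rewrite ?mulr_ge0 // ?ler_nat; first exact: leq_bin2l.
  by apply: (le_trans degH); rewrite ler_nat; exact: codeg_ge.
rewrite -(ler_nat R) natrM natrX; apply: le_trans tail.
apply: ler_pM; rewrite ?ler0n // card_bool_sum natr_sum ler_sum // => b _.
rewrite ler_nat; case: ltnP => //= lt_t.
suff -> : g b < thr by [].
by apply: lt_le_trans mu_ge; rewrite /g ltr_nat.
Qed.

(** * Choice of the constants *)

Section Numerics.
Variable R : realType.

Lemma exists_nat_ge (x : R) : exists N : nat, forall M, (N <= M)%N -> x <= M%:R.
Proof.
exists (Num.truncn x).+1 => M NM; apply: le_trans (ltW (truncnS_gt x)) _.
by rewrite ler_nat.
Qed.

Lemma bernoulli_sub (x : R) j : 0 <= x -> x <= 1 -> 1 - j%:R * x <= (1 - x) ^+ j.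
Proof.
move=> x0 x1; elim: j => [|j IHj]; first by rewrite expr0 mul0r subr0.
have : (1 - x) * (1 - j%:R * x) <= (1 - x) ^+ j.+1 by rewrite exprS ler_wpM2l // subr_ge0.
apply: le_trans; rewrite -natr1; have : 0 <= j%:R * x * x by rewrite !mulr_ge0 ?ler0n.
by lra.
Qed.

Lemma leq_ffact_sub (m j : nat) : ((m - j) ^ j <= m ^_ j)%N.
Proof.
suff h i : (i <= j)%N -> ((m - j) ^ i <= m ^_ i)%N by exact: h.
elim: i => // i IHi ij; rewrite expnSr ffactnSr leq_mul ?IHi ?leq_sub2l ?(ltnW ij) //.
Qed.

Lemma expR_ge_pow (x : R) m : 0 <= x -> (0 < m)%N -> (x / m%:R) ^+ m <= expR x.
Proof.
move=> x0 m0; have mR : (m%:R : R) != 0 by rewrite pnatr_eq0 -lt0n.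
have {2}-> : x = x / m%:R * m%:R by rewrite divfK.
rewrite expRM_natr ler_pXn2r ?nnegrE ?expR_ge0 ?divr_ge0 ?ler0n //.
by have := expR_ge1Dx (x / m%:R); lra.
Qed.

Lemma sampling_numbers (d k : nat) (p eps : R) : (d < k)%N -> 0 <= p -> 0 < eps -> eps <= 1 ->
  exists tau (s0 : nat), [/\ 0 <= tau, tau <= 2 / 3 & forall s, (s0 <= s)%N ->
  [/\ (k <= s)%N, (4 * s.+1 ^ d.+1)%:R <= expR (tau ^+ 2 * s.+1%:R / 4) &
  exists n0 : nat, forall n, (n0 <= n)%N ->
  (p - eps) * 'C(s.+1 - d, k - d)%:R + 1 <=
    'C(s - d, k - d)%:R * (p * 'C(n - d, k - d)%:R) * (k - d)`!%:R / n%:R ^+ (k - d)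
    - tau * s.+1%:R ^+ (k - d)]].
Proof.
move=> dk p0 eps0 eps1; set j := (k - d)%N; have j0 : (0 < j)%N by rewrite subn_gt0.
set q : R := 2 ^+ j * j`!%:R.
have q1 : 1 <= q by rewrite /q -natrX -natrM ler1n muln_gt0 expn_gt0 fact_gt0.
pose tau := eps / (8 * q); exists tau.
have q0 : 0 < q by lra.
have tau0 : 0 < tau by apply: divr_gt0 => //; lra.
have tauq : tau * (8 * q) = eps by rewrite /tau divfK //; lra.
pose kap := tau ^+ 2 / 4 / d.+2%:R.
have kap0 : 0 < kap by rewrite !divr_gt0 ?exprn_gt0 ?ltr0n.
have [s1 Hs1] := exists_nat_ge (4 / kap ^+ d.+2).
have [s2 Hs2] := exists_nat_ge (4 * p * j%:R / eps).
have [s3 Hs3] := exists_nat_ge (1 / tau).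
exists (s1 + (s2 + d) + s3 + 2 * k)%N; split; [exact: ltW | nra |].
move=> s sge; have ks : (k <= s)%N by clear -sge; lia.
have sd : (s.+1 - d = (s - d).+1)%N by clear -ks dk; lia.
have jsd : (j <= s.+1 - d)%N by rewrite /j; clear -ks dk; lia.
have S0 : 0 < (s.+1%:R : R) by rewrite ltr0n.
split=> //.
  apply: le_trans (expR_ge_pow _ (ltn0Sn d.+1)); last first.
    by rewrite divr_ge0 // mulr_ge0 ?sqr_ge0 // ltW.
  have -> : tau ^+ 2 * s.+1%:R / 4 / d.+2%:R = kap * s.+1%:R.
    by rewrite /kap -!mulrA [s.+1%:R * _]mulrC -!mulrA.
  rewrite exprMn [s.+1%:R ^+ _]exprS mulrA natrM natrX ler_wpM2r ?exprn_ge0 ?(ltW S0) //.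
  have : 4 / kap ^+ d.+2 <= s.+1%:R by apply: Hs1; clear -sge; lia.
  by rewrite ler_pdivrMr ?exprn_gt0 // [_ * s.+1%:R]mulrC.
set C : R := 'C(s.+1 - d, j)%:R; set A : R := 'C(s - d, j)%:R.
have C0 : 0 <= C by rewrite ler0n.
have CS : s.+1%:R ^+ j <= q * C.
  rewrite /q /C -!natrX -!natrM ler_nat.
  apply: (@leq_trans (2 ^ j * (s.+1 - k) ^ j)%N).
    by rewrite -expnMn leq_exp2r //; clear -sge; lia.
  rewrite -mulnA leq_mul2l [(j`! * _)%N]mulnC bin_ffact; apply/orP; right.
  by apply: leq_trans (leq_ffact_sub _ _); rewrite leq_exp2r // /j; clear -dk ks; lia.
have AC : p * C - p * A <= eps / 4 * C.
  have := mul_bin_down (s.+1 - d) j.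
  rewrite sd /= -sd => /(congr1 (fun z : nat => z%:R : R)).
  rewrite !natrM (natrB _ jsd) -/A -/C => E.
  have x0 : 0 < ((s.+1 - d)%:R : R) by rewrite ltr0n sd.
  have := Hs2 (s.+1 - d)%N; rewrite ler_pdivrMr // => /(_ _) h.
  have {}h : 4 * p * j%:R <= (s.+1 - d)%:R * eps by apply: h; clear -sge; lia.
  rewrite -(ler_pM2l x0).
  have -> : (s.+1 - d)%:R * (p * C - p * A) = p * j%:R * C.
    by rewrite mulrBr ![_ * (p * _)]mulrCA E; ring.
  by rewrite mulrA ler_wpM2r //; clear -h; lra.
have one_le : 1 <= tau * s.+1%:R ^+ j.
  apply: (@le_trans _ _ (tau * s.+1%:R)).
    have : 1 / tau <= s.+1%:R by apply: Hs3; clear -sge; lia.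
    by rewrite ler_pdivrMr // mulrC.
  by rewrite ler_wpM2l ?(ltW tau0) // -[leLHS]expr1 ler_weXn2l // ler1n.
have tauC : tau * s.+1%:R ^+ j <= eps / 8 * C.
  apply: (@le_trans _ _ (tau * (q * C))); first by rewrite ler_wpM2l // ltW.
  by rewrite -tauq; lra.
have [n1 Hn1] := exists_nat_ge (4 * p * A * j%:R * k%:R / eps).
exists (n1 + k).+1 => n nge.
have [kn n1n] : (k <= n)%N /\ (n1 <= n)%N by clear -nge; lia.
have n0 : 0 < (n%:R : R) by rewrite ltr0n (leq_trans _ kn) // (leq_trans _ dk).
set B : R := 'C(n - d, j)%:R * j`!%:R / n%:R ^+ j.
have -> : A * (p * 'C(n - d, j)%:R) * j`!%:R / n%:R ^+ j = p * A * B by rewrite /B; ring.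
have B1 : 1 - j%:R * (k%:R / n%:R) <= B.
  apply: le_trans (bernoulli_sub _ _ _) _.
  - by rewrite divr_ge0 ?ler0n.
  - by rewrite ler_pdivrMr // mul1r ler_nat.
  rewrite /B ler_pdivlMr ?exprn_gt0 // -exprMn mulrBl mul1r divfK ?lt0r_neq0 //.
  rewrite -natrB //.
  rewrite -natrX -natrM ler_nat bin_ffact; apply: leq_trans (leq_ffact_sub _ _).
  by rewrite leq_exp2r // /j; clear -kn dk; lia.
have AB : p * A * (j%:R * (k%:R / n%:R)) <= eps / 4.
  have -> : p * A * (j%:R * (k%:R / n%:R)) = (4 * p * A * j%:R * k%:R / eps) * (eps / 4) / n%:R.
    by field; rewrite !lt0r_neq0.
  rewrite ler_pdivrMr // mulrC ler_wpM2l //; first lra.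
  exact: Hn1.
have C1 : 1 <= C.
  by rewrite /C ler1n bin_gt0.
have pA0 : 0 <= p * A by rewrite mulr_ge0 // ler0n.
have := ler_wpM2l pA0 B1; nra.
Qed.

Lemma limn_sup_lt_eventually (u : nat -> R) (e : R) : 0 < e -> (forall N, 0 <= u N <= 1) ->
  exists N0, forall N, (N0 <= N)%N -> u N < limn_sup u + e.
Proof.
move=> e0 u01.
have ub : bounded_fun u.
  exists 1; split=> // M M1 N _ /=; rewrite ger0_norm; have /andP[u0 u1] := u01 N => //.
  by apply: le_trans u1 (ltW M1).
rewrite limn_supE //; have := bounded_fun_has_lbound_sups ub => lb.
have hi : has_inf (range (sups u)) by split=> //; exists (sups u 0%N); exists 0%N.
have [_ [N0 _ <-] lt_e] := inf_adherent e0 hi.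
exists N0 => N NN; apply: le_lt_trans lt_e.
apply: ub_le_sup; last by exists N => //=.
exact: (has_ubound_sdrop (bounded_fun_has_ubound ub)).
Qed.

(** The ratios lie in [[0, 1]], also where the binomial vanishes and the quotient is [0], so the
    limsup bounds them eventually. The lower bound on [dLHC] will make the sampled density
    nonnegative. *)
Lemma dLHC_upper (k d : nat) (e : R) : (d < k)%N -> (1 < k)%N -> 0 < e -> 
  - e < dLHC R k d /\
  exists N0 : nat, forall N, (N0 <= N)%N -> 
    (dLHC_n k d ((k - 1) * N))%:R <= (dLHC R k d + e) * 'C((k - 1) * N - d, k - d)%:R.
Proof.
move=> dk k1 e0; rewrite /dLHC; set u := fun N => _.
have u01 N : 0 <= u N <= 1.
  rewrite /u divr_ge0 ?ler0n //=; have [->|] := posnP 'C((k - 1) * N - d, k - d).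
    by rewrite invr0 mulr0.
  move=> C0; rewrite ler_pdivrMr ?ltr0n // mul1r ler_nat; apply: dLHC_n_le_bin.
  by rewrite leqNgt; apply: contraTN C0 => h; rewrite (eqP (ltnW h)) bin0n; lia.
have [N0 HN] := limn_sup_lt_eventually e0 u01; split.
  by have := HN N0 (leqnn _); have /andP[u0 _] := u01 N0; lra.
exists (N0 + k)%N => N NN; have {}HN := HN N (leq_trans (leq_addr _ _) NN).
have C0 : 0 < ('C((k - 1) * N - d, k - d)%:R : R).
  rewrite ltr0n bin_gt0; apply: leq_sub2r; apply: (leq_trans (leq_trans (leq_addl N0 k) NN)).
  by apply: leq_pmull; rewrite subn_gt0.
by apply: ltW; rewrite -ltr_pdivrMr.
Qed.

(** With [M = D * m], the left side is at most [(4 K) ^ (M + (M + 2) ^ S)], whose logarithm is at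
    most [8 K (D + 2)^S m^S]; a further factor [m] absorbs the constant. *)
Lemma tower_bound (S D K m n : nat) : (0 < K)%N -> (0 < S)%N -> (0 < m)%N ->
  (8 * K * (D + 2) ^ S <= m)%N -> m%:R ^+ S.+2 <= ln (n%:R : R) -> (0 < n)%N ->
  (D * m * (4 * K) ^ ((D * m + 2) ^ S) <= n)%N.
Proof.
move=> K0 S0 m0 Dm mn n0; set M := (D * m)%N.
have K4 : (1 < 4 * K)%N by lia.
apply: (@leq_trans ((4 * K) ^ (M + (M + 2) ^ S)))%N.
  by rewrite expnD leq_mul2r ltnW ?orbT // ltn_expl.
have nR : 0 < (n%:R : R) by rewrite ltr0n.
rewrite -(ler_nat R) natrX -ler_ln ?posrE ?exprn_gt0 ?ltr0n //; last lia.
rewrite lnXn ?ltr0n; last lia.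
apply: le_trans mn; rewrite -[leLHS]mulr_natl.
apply: (@le_trans _ _ ((M + (M + 2) ^ S)%:R * (4 * K)%:R)).
  by rewrite ler_wpM2l ?ler0n // ltW // ln_sublinear // ltr0n; lia.
rewrite -natrM -natrX ler_nat.
have MD : (M + 2 <= (D + 2) * m)%N by rewrite /M mulnDl leq_add2l leq_pmulr.
have MS : (M <= (M + 2) ^ S)%N.
  by apply: (@leq_trans ((M + 2) ^ 1))%N; [rewrite expn1 leq_addr | rewrite leq_pexp2l // addn2].
apply: (@leq_trans (8 * K * (D + 2) ^ S * m ^ S))%N.
  have : ((M + 2) ^ S <= (D + 2) ^ S * m ^ S)%N by rewrite -expnMn leq_exp2r.
  nia.
rewrite expnS leq_mul // expnS leq_pmull //.
Qed.

Lemma truncn_ln_powR (S L : nat) (c : R) : 0 < c -> c <= S%:R^-1 -> (0 < S)%N ->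
  exists n0 : nat, forall n, (n0 <= n)%N ->
  let m := Num.truncn (powR (ln (n%:R : R)) c) in
  [/\ (0 < n)%N, (L <= m)%N & m%:R ^+ S <= ln (n%:R : R)].
Proof.
move=> c0 cS S0; have [n0 Hn] := exists_nat_ge (expR (1 + L%:R `^ c^-1)).
exists n0.+1 => n nge m; have n1 : (0 < n)%N by lia.
have nR : 0 < (n%:R : R) by rewrite ltr0n.
have lnn : 1 + L%:R `^ c^-1 <= ln (n%:R : R).
  by rewrite -[leLHS]expRK ler_ln ?posrE ?expR_gt0 //; apply: Hn; lia.
have pL := powR_ge0 (L%:R : R) c^-1.
have ln1 : 1 <= ln (n%:R : R) by lra.
split=> //.
  rewrite /m truncn_ge_nat ?powR_ge0 //.
  have -> : (L%:R : R) = (L%:R `^ c^-1) `^ c.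
    by rewrite -powRrM mulVf ?lt0r_neq0 // powRr1.
  by apply: ge0_ler_powR; rewrite ?nnegrE //; lra.
have mle : m%:R <= powR (ln (n%:R : R)) c by rewrite /m truncn_le powR_ge0.
apply: (@le_trans _ _ (powR (ln (n%:R : R)) c ^+ S)).
  by rewrite ler_pXn2r // nnegrE ?ler0n ?powR_ge0.
rewrite -powR_mulrn ?powR_ge0 // -powRrM -[leRHS]powRr1; last lra.
apply: ler_powR => //; apply: (@le_trans _ _ (S%:R^-1 * S%:R)).
  by rewrite ler_wpM2r ?ler0n.
by rewrite mulVf // pnatr_eq0 -lt0n.
Qed.

End Numerics.

(** * Tiling with blow-ups *)

Lemma card_LCV (k l : nat) : (1 < k)%N -> #|LCV k l| = (l * (k - 1))%N.
Proof.
move=> k1; rewrite card_sum card_prod !card_ord.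
have -> : (k - 1 = (k - 2).+1)%N by lia.
by rewrite mulnS.
Qed.

Lemma pattern_blowup (k l s n m : nat) (H : {set {set 'I_n}}) (phi : {ffun LCV k l -> 'I_s})
    (a : 'I_s * 'I_m -> 'I_n) :
  (0 < m)%N -> injective a -> (forall g : 'I_s -> 'I_m, pattern H phi [ffun i => a (i, g i)]) ->
  blowup_copy H (fun p => a (phi p.1, p.2)).
Proof.
move=> m0 ainj Hphi.
have /and3P[_ /injectiveP phi_inj _] := Hphi (fun=> Ordinal m0).
split=> [[x b] [x' b'] /ainj [/phi_inj -> ->] //|e eE g].
(* Carries a choice on the vertices of the cycle over to positions; [Ordinal m0] is a default off
   the image of [phi]. *)
pose g' i := if [pick x | phi x == i] is Some x then g x else Ordinal m0.
have g'E x : g' (phi x) = g x.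
  rewrite /g'; case: pickP => [y /eqP/phi_inj -> //|/(_ x)].
  by rewrite eqxx.
have /and3P[_ _ /forall_inP/(_ e eE)] := Hphi g'.
congr (_ \in H); rewrite -imset_comp; apply: eq_imset => x /=.
by rewrite ffunE g'E.
Qed.

Lemma disjoint_blowups (k l s n m h t d : nat) (H : {set {set 'I_n}})
    (K := pattern_bound {ffun LCV k l -> 'I_s.+1} s (h ^ 4)) (M := ((h ^ 4 + 2 * h ^ 3) * m)%N) :
  (1 < k)%N -> s.+1 = (l * (k - 1))%N -> kgraph k H -> (dLHC_n k d s.+1 < t)%N ->
  (0 < n)%N -> (0 < h)%N -> (0 < m)%N ->
  (forall w : 'I_n, #|[set g : {ffun 'I_s -> 'I_n} |
     ~~ (injectiveb (fcons w g) && (t <= min_codeg d (pullback H (fcons w g)))%N)]|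
       * (2 * s.+1) <= n ^ s)%N ->
  (M * (4 * K) ^ ((M + 2) ^ s.+1) <= n)%N ->
  exists (r : nat) (F : 'I_r -> (LCV k l * 'I_m -> 'I_n)),
    [/\ forall i, blowup_copy H (F i),
        forall i j, i != j -> forall p q, F i p != F j q &
        (#|~: (\bigcup_(i < r) [set F i p | p : LCV k l * 'I_m])| * h <= (3 + 8 * s.+1) * n)%N].
Proof.
move=> k1 sl kH tt n0 h0 m0 bad Mn.
pose P (x : {ffun 'I_s.+1 -> 'I_n}) := injectiveb x && (t <= min_codeg d (pullback H x))%N.
have n0' : (0 < #|'I_n|)%N by rewrite card_ord.
have bad' w : (#|[set g | ~~ P (fcons w g)]| * (2 * s.+1) <= #|'I_n| ^ s)%N.
  by rewrite card_ord; exact: bad.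
have PQ x : P x -> exists phi : {ffun LCV k l -> 'I_s.+1}, pattern H phi x.
  move=> /andP[/injectiveP xinj xt]; apply: hasLHC_pattern => //.
  by apply: (@hasLHC_min_codeg k d); [exact: kgraph_pullback | exact: leq_trans tt xt].
have Qinj phi x : pattern H (phi : {ffun LCV k l -> 'I_s.+1}) x -> injective x.
  by case/and3P=> /injectiveP.
have [|N [J [c [f [finj fQ cover]]]]] := almost_tiling n0' bad' PQ Qinj h0 m0.
  by rewrite card_ord; exact: Mn.
rewrite card_ord in cover.
pose a (i : 'I_#|J|) (p : 'I_s.+1 * 'I_m) := f (enum_val i, p.1, p.2).
have ainj i : injective (a i).
  move=> [p b] [p' b'] /finj; rewrite !inE /= !enum_valP => /(_ isT isT) [-> ->].
  by [].
exists #|J|, (fun i p => a i (c (enum_val i) p.1, p.2)).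
have F_copy i : blowup_copy H (fun p => a i (c (enum_val i) p.1, p.2)).
  by apply: pattern_blowup => // g; apply: fQ; exact: enum_valP.
have F_disj i j : i != j -> forall p q,
    a i (c (enum_val i) p.1, p.2) != a j (c (enum_val j) q.1, q.2).
  move=> ij p q; apply: contra ij => /eqP /finj.
  by rewrite !inE /= !enum_valP => /(_ isT isT) [/enum_val_inj ->].
split=> //; set U := \bigcup_(i < _) _.
have cardU : (s.+1 * m * #|J| <= #|U|)%N.
  pose Phi (q : 'I_#|J| * (LCV k l * 'I_m)) := a q.1 (c (enum_val q.1) q.2.1, q.2.2).
  have Phi_inj : injective Phi.
    move=> [i p] [i' p']; rewrite /Phi /=; have [<-|ii'] := eqVneq i i'.
      by move=> /(F_copy i).1 ->.
    by move=> E; have := F_disj _ _ ii' p p'; rewrite E eqxx.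
  have -> : (s.+1 * m * #|J| = #|[set Phi q | q : 'I_#|J| * (LCV k l * 'I_m)]|)%N.
    by rewrite card_imset // !card_prod !card_ord card_LCV // -sl mulnC.
  apply/subset_leq_card/fintype.subsetP=> _ /imsetP[[i p] _ ->].
  by apply/bigcupP; exists i => //; apply/imsetP; exists p.
apply: leq_trans cover; rewrite leq_mul2r cardsCs finset.setCK card_ord.
by rewrite leq_sub2l // orbT.
Qed.

Unset Implicit Arguments.

Theorem theorem4p6 (R : realType) (k d : nat) :
  (1 <= d)%N -> (d < k)%N ->
  forall eps : R, 0 < eps ->
  exists l0 : nat, forall l : nat, (l0 <= l)%N ->
  exists c0 eta0 : R, 0 < c0 /\ 0 < eta0 /\
  forall c eta : R, 0 < c -> c <= c0 -> 0 < eta -> eta <= eta0 ->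
  exists n0 : nat, forall n : nat, (n0 <= n)%N ->
  let m := Num.truncn (powR (ln (n%:R : R)) c) in
  forall H : {set {set 'I_n}}, kgraph k H ->
    (dLHC R k d + eps) * ('C(n - d, k - d))%:R <= (min_codeg d H)%:R ->
    exists (t : nat) (F : 'I_t -> (LCV k l * 'I_m -> 'I_n)),
      (forall i, blowup_copy H (F i)) /\
      (forall i j, i != j -> forall p q, F i p != F j q) /\
      (#|~: (\bigcup_(i < t) [set F i p | p : LCV k l * 'I_m])|%:R <= eta * n%:R).
Proof.
move=> d1 dk eps eps0; have k1 : (1 < k)%N by apply: leq_ltn_trans dk.
pose e := Num.min eps 1; have e0 : 0 < e by rewrite lt_min eps0 ltr01.
have e1 : e <= 1 by rewrite ge_min lexx orbT.
have ee : e <= eps by rewrite ge_min lexx.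
(* One half of [e] covers the passage from the limsup to the threshold on [s.+1] vertices, the other
   half the sampling error. *)
have e2 : 0 < e / 2 by rewrite divr_gt0.
have [lo [N0 HN]] := dLHC_upper dk k1 e2.
set del := dLHC R k d in lo HN *.
have p0 : 0 <= del + e by lra.
have e21 : e / 2 <= 1 by lra.
have [tau [s0 [tau0 tau1 Hs]]] := sampling_numbers dk p0 e2 e21.
exists (N0 + s0).+1 => l ll; pose s := (l * (k - 1)).-1.
have k10 : (0 < k - 1)%N by rewrite subn_gt0.
have lk : (l <= l * (k - 1))%N by rewrite leq_pmulr.
have sl : s.+1 = (l * (k - 1))%N by rewrite /s prednK // (leq_trans _ lk) // (leq_trans _ ll).
have ss0 : (s0 <= s)%N by rewrite -ltnS sl; apply: leq_trans lk; apply: leq_trans ll; rewrite ltnS leq_addl.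
have [ks Bexp [n1 Hn1]] := Hs s ss0.
have dLHC_le : (dLHC_n k d s.+1)%:R <= (del + e / 2) * 'C(s.+1 - d, k - d)%:R.
  by rewrite sl mulnC; apply: HN; apply: leq_trans ll; rewrite leqW // leq_addr.
(* [s.+3] is the exponent [S.+2] of [tower_bound] for [S = s.+1]. *)
exists (s.+3%:R^-1), 1; split; first by rewrite invr_gt0 ltr0n.
split=> // c eta c0 cS eta0 _.
have [h0 Hh] := exists_nat_ge ((3 + 8 * s.+1)%:R / eta); pose h := h0.+1.
have hge : (3 + 8 * s.+1)%:R <= eta * h%:R.
  by rewrite mulrC -ler_pdivrMr //; apply: Hh.
pose K := pattern_bound {ffun LCV k l -> 'I_s.+1} s (h ^ 4).
pose D := (h ^ 4 + 2 * h ^ 3)%N.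
have K0 : (0 < K)%N.
  rewrite /K /pattern_bound muln_gt0; apply/andP; split; first by rewrite muln_gt0 addn2.
  by rewrite card_ffun expn_gt0 card_ord.
have [n2 Hn2] := truncn_ln_powR (8 * K * (D + 2) ^ s.+1).+1 c0 cS (ltn0Sn _).
exists (n1 + n2 + 4 * s.+1 ^ 3)%N => n nge m H kH degH.
have [n1n n2n n3n] : [/\ (n1 <= n)%N, (n2 <= n)%N & (4 * s.+1 ^ 3 <= n)%N].
  by split; apply: leq_trans nge; [rewrite -addnA leq_addr | rewrite addnAC leq_addl | rewrite leq_addl].
have [n_gt0 mge mln] := Hn2 n n2n; rewrite -/m in mge mln.
have m0 : (0 < m)%N by apply: leq_trans mge.
have degH' : (del + e) * 'C(n - d, k - d)%:R <= (min_codeg d H)%:R.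
  by apply: le_trans degH; rewrite ler_wpM2r ?ler0n // lerD2l.
have ds : (d <= s.+1)%N by apply: leq_trans (ltnW dk) (leq_trans ks (leqnSn s)).
have tle : (dLHC_n k d s.+1).+1%:R <= (del + e - e / 2) * 'C(s.+1 - d, k - d)%:R + 1.
  by rewrite -natr1 lerD2r; have -> : del + e - e / 2 = del + e / 2 by lra.
have bad w := @card_bad_link n d k s (dLHC_n k d s.+1).+1 H w ds n3n
  (fun T a Td ainj => few_extensions_tail dk (leq_trans ks (leqnSn s)) n_gt0 kH Td ainj degH' p0
     tau0 tau1 (le_trans tle (Hn1 n n1n)) Bexp).
have tower := tower_bound K0 (ltn0Sn s) m0 (ltnW mge) mln n_gt0.
have [r [F [FH Fdisj cover]]] := disjoint_blowups k1 sl kH (ltnSn _) n_gt0 (ltn0Sn h0) m0 bad tower.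
exists r, F; split=> //; split=> //.
have hR : 0 < (h%:R : R) by rewrite ltr0n.
rewrite -(ler_pM2r hR) -natrM mulrAC; apply: (@le_trans _ _ ((3 + 8 * s.+1) * n)%:R).
  by rewrite ler_nat.
by rewrite natrM ler_wpM2r ?ler0n.
Qed.
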